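(* Let $f$ be a regulated function on $[a,b]$, and let $\lambda\in\Lambda[a,b]$ be such that $\{t\in(a,b):\Delta^+f(t)\ne0\}\subset\cup\lambda$. The following statements about $f$ are equivalent: (a) $f$ has the quadratic $\lambda$-variation on $[a,b]$; (b) for every $C^1$ class function $\psi:\mathbb R\to\mathbb R$, the composition $\psi\circ f$ is Left Cauchy $\lambda$-integrable on $[a,b]$ with respect to $f$, and for any $a\le s<t\le b$, $$(\Psi\circ f)(t)=(\Psi\circ f)(s)+(LC)\int_s^t(\psi\circ f)\,d_\lambda f+\frac12(RS)\int_s^t(\psi'\circ f)\,d[f]^c_\lambda$$ $$+\sum_{(s,t]}\big\{\Delta^-(\Psi\circ f)-(\psi\circ f)_-\Delta^-f\big\}+\sum_{[s,t)}\big\{\Delta^+(\Psi\circ f)-(\psi\circ f)\Delta^+f\big\},$$ where the two sums converge unconditionally and $\Psi(u)=\Psi(0)+\int_0^u\psi(x)\,dx$, $u\in\mathbb R$; (c) $f$ is Left Cauchy $\lambda$-integrable on $[a,b]$ with respect to itself. If any of the three statements holds, then for $a\le t\le b$, $$(LC)\int_a^tf\,d_\lambda f=\frac12\big\{f^2(t)-f^2(a)-[f]_\lambda(t)\big\}.$$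
   Context: Fix real $a<b$. A function $f:[a,b]\to\mathbb R$ is regulated if the finite limits $f(t-)$, $t\in(a,b]$, and $f(s+)$, $s\in[a,b)$, exist; $f_-(t)=f(t-)$, $\Delta^-f(t)=f(t)-f(t-)$, $\Delta^+f(s)=f(s+)-f(s)$. $\Lambda[a,b]$ is the set of sequences $\lambda=\{\lambda_m:m\ge1\}$ of partitions (finite sets $a=t_0<\dots<t_n=b$) of $[a,b]$ with $\lambda_m\subset\lambda_{m+1}$ and $\cup\lambda:=\bigcup_m\lambda_m$ dense in $[a,b]$. For $a\le s<t\le b$ let $\lambda_m|_{[s,t]}=\{s,t\}\cup(\lambda_m\cap(s,t))=\{s=x_0<\dots<x_n=t\}$. A sum over the points of an interval converges unconditionally if the finite partial sums converge along finite subsets directed by inclusion (equivalently, absolutely). A regulated $f$ has the quadratic $\lambda$-variation on $[a,b]$ if there is a regulated $V$ with $V(a)=0$ and, for all $a\le s<t\le b$, $V(t)-V(s)=\lim_{m\to\infty}\sum_i[f(x_i)-f(x_{i-1})]^2$ (sum over $\lambda_m|_{[s,t]}$), $\Delta^-V(t)=(\Delta^-f(t))^2$, $\Delta^+V(s)=(\Delta^+f(s))^2$. Then $[f]_\lambda:=V$ (the bracket function, nondecreasing), and its continuous part is $[f]^c_\lambda(t)=[f]_\lambda(t)-\sum_{(a,t]}(\Delta^-f)^2-\sum_{[a,t)}(\Delta^+f)^2$. For regulated $g,f$, $g$ is Left Cauchy $\lambda$-integrable on $[a,b]$ with respect to $f$ if there is a regulated $\Phi$ with $\Phi(a)=0$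 and, for all $a\le s<t\le b$, $\Phi(t)-\Phi(s)=\lim_{m\to\infty}\sum_ig(x_{i-1})[f(x_i)-f(x_{i-1})]$ (sum over $\lambda_m|_{[s,t]}$), $\Delta^-\Phi(t)=g(t-)\Delta^-f(t)$, $\Delta^+\Phi(s)=g(s)\Delta^+f(s)$; then $(LC)\int_s^tg\,d_\lambda f:=\Phi(t)-\Phi(s)$. $(RS)\int$ is the Riemann–Stieltjes integral. *)

(* Defs.v *)
From HB Require Import structures.
From mathcomp Require Import all_boot all_order all_algebra finmap.
From mathcomp Require Import all_classical all_reals all_analysis.
From mathcomp Require Import showcase.summability.

Set Implicit Arguments.
Unset Strict Implicit.
Unset Printing Implicit Defensive.

Import Order.TTheory GRing.Theory Num.Theory.
Import numFieldNormedType.Exports.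

Local Open Scope classical_set_scope.
Local Open Scope ring_scope.

(* A function on [a, b] is represented by a total function R -> R; every notion
   below depends only on its values on [a, b].

   Objects that the mathematics defines only under an existence condition (sum,
   Riemann-Stieltjes integral, bracket, Left Cauchy integral) are total here,
   with an arbitrary or zero default; the existence conditions are the separate
   predicates usummable, RS_integrable, has_qvar and LC_integrable. *)

Section Defs.
Variable R : realType.
Implicit Types (a b s t : R) (f g h psi V Phi : R -> R) (lam : nat -> seq R).

Definition leftlim f t : R := lim (f x @[x --> t^'-]).
Definition rightlim f t : R := lim (f x @[x --> t^'+]).

Definition regulated a b f : Prop :=
  (forall t, t \in `]a, b] -> cvg (f x @[x --> t^'-])) /\
  (forall s, s \in `[a, b[ -> cvg (f x @[x --> s^'+])).

Definition jumpL f t : R := f t - leftlim f t.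
Definition jumpR f s : R := rightlim f s - f s.

(* As in itv_partition, the partition a = t_0 < ... < t_n = b is represented by
   the sequence t_1, ..., t_n, without its left endpoint.  The sequence of
   partitions is indexed from 0 instead of 1. *)
Definition partition_points a lam : set R :=
  [set x | exists m, x \in a :: lam m].

Definition refining_partitions a b lam : Prop :=
  [/\ forall m, itv_partition a b (lam m),
      forall m, {subset lam m <= lam m.+1} &
      `[a, b]%classic `<=` closure (partition_points a lam)].

(* The partition {s, t} `|` (lam m `&` ]s, t[) of [s, t], without s. *)
Definition trace_partition lam s t (m : nat) : seq R :=
  rcons [seq x <- lam m | s < x < t] t.

(* Sum of F x_{i-1} x_i over the partition s = x_0 < x_1 < ... < x_n, where
   p = [:: x_1; ...; x_n]. *)
Definition partition_sum (F : R -> R -> R) s (p : seq R) : R :=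
  \sum_(0 <= i < size p) F (nth s (s :: p) i) (nth s p i).

(* Unconditional sums over D, that is, limits of the finite partial sums along
   the finite sets directed by inclusion; u \_ D is u on D and 0 outside. *)
Definition usummable (D : set R) (u : R -> R) : Prop :=
  cvg (partial_sum (u \_ D) @ totally).
Definition usum (D : set R) (u : R -> R) : R :=
  lim (partial_sum (u \_ D) @ totally).

Definition is_qvar a b lam f V : Prop :=
  [/\ regulated a b V,
      V a = 0,
      forall s t, a <= s -> s < t -> t <= b ->
        partition_sum (fun x y => (f y - f x) ^+ 2) s (trace_partition lam s t m)
          @[m --> \oo] --> V t - V s,
      forall t, t \in `]a, b] -> jumpL V t = jumpL f t ^+ 2 &
      forall s, s \in `[a, b[ -> jumpR V s = jumpR f s ^+ 2].

Definition has_qvar a b lam f : Prop :=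
  regulated a b f /\ exists V, is_qvar a b lam f V.

Definition bracket a b lam f : R -> R :=
  xget (fun=> 0) [set V | is_qvar a b lam f V].

Definition bracketc a b lam f t : R :=
  bracket a b lam f t - usum `]a, t] (fun x => jumpL f x ^+ 2)
                      - usum `[a, t[ (fun x => jumpR f x ^+ 2).

Definition is_LC a b lam g f Phi : Prop :=
  [/\ regulated a b Phi,
      Phi a = 0,
      forall s t, a <= s -> s < t -> t <= b ->
        partition_sum (fun x y => g x * (f y - f x)) s (trace_partition lam s t m)
          @[m --> \oo] --> Phi t - Phi s,
      forall t, t \in `]a, b] -> jumpL Phi t = leftlim g t * jumpL f t &
      forall s, s \in `[a, b[ -> jumpR Phi s = g s * jumpR f s].

Definition LC_integrable a b lam g f : Prop :=
  [/\ regulated a b g, regulated a b f & exists Phi, is_LC a b lam g f Phi].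

Definition LC_int a b lam g f s t : R :=
  let Phi := xget (fun=> 0) [set Phi | is_LC a b lam g f Phi] in Phi t - Phi s.

(* Riemann-Stieltjes integral of h with respect to g over [s, t], as a limit of
   tagged sums when the mesh tends to 0; xi i is the tag in [x_i, x_{i+1}]. *)
Definition is_RS h g s t (I : R) : Prop :=
  forall e, 0 < e -> exists2 d, 0 < d &
    forall (p : seq R) (xi : nat -> R), itv_partition s t p ->
      (forall i, (i < size p)%N ->
         nth s p i - nth s (s :: p) i < d /\
         nth s (s :: p) i <= xi i <= nth s p i) ->
      `|\sum_(0 <= i < size p) h (xi i) * (g (nth s p i) - g (nth s (s :: p) i))
        - I| < e.

Definition RS_integrable h g s t : Prop := exists I, is_RS h g s t I.

Definition RS_int h g s t : R := xget 0 [set I | is_RS h g s t I].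

Definition C1 psi : Prop :=
  (forall x, derivable psi x 1) /\ continuous (derive1 psi : R -> R).

Definition oriented_int psi (u : R) : R :=
  if 0 <= u then \int[lebesgue_measure]_(x in `[0, u]) psi x
  else - \int[lebesgue_measure]_(x in `[u, 0]) psi x.

(* Existence of the bracket of f is deliberately not part of this property: it
   has to be derived from the integrability of psi \o f for all psi. *)
Definition has_ito_formula a b lam f : Prop :=
  forall psi, C1 psi ->
    LC_integrable a b lam (psi \o f) f /\
    forall Psi : R -> R, (forall u, Psi u = Psi 0 + oriented_int psi u) ->
    forall s t, a <= s -> s < t -> t <= b ->
      let JL x := jumpL (Psi \o f) x - leftlim (psi \o f) x * jumpL f x in
      let JR x := jumpR (Psi \o f) x - (psi \o f) x * jumpR f x in
      [/\ RS_integrable (derive1 psi \o f) (bracketc a b lam f) s t,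
          usummable `]s, t] JL,
          usummable `[s, t[ JR &
          (Psi \o f) t =
            (Psi \o f) s + LC_int a b lam (psi \o f) f s t
            + 2^-1 * RS_int (derive1 psi \o f) (bracketc a b lam f) s t
            + usum `]s, t] JL + usum `[s, t[ JR].

End Defs.

(* Main.v *)
Require Import Defs.
From HB Require Import structures.
From mathcomp Require Import all_boot all_order all_algebra finmap.
From mathcomp Require Import all_classical all_reals all_analysis.
From mathcomp Require Import showcase.summability.
From mathcomp Require Import ring lra.

(** The heart of the matter is that the quadratic variation V of f determines the
    limit of much more general sums. Let K(u, v) be a function that behaves like
    h(u) (v - u)^2 near the diagonal, h being continuous. The sums of
    K(f(x_{i-1}), f(x_i)) over the traces of the partitions then converge to

      (integral of h o f against the continuous part of V)
      + (sum of the K(f(x-), f(x))) + (sum of the K(f(x), f(x+))).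

    For the Taylor remainder K(u, v) = Psi(v) - Psi(u) - psi(u) (v - u), where
    h = psi' / 2, the sum of K is the increment of Psi o f minus the Left Cauchy sum
    of psi o f. Hence the latter converges, and its limit is given by the change
    of variables formula: (a) implies (b). The choice of psi as the identity gives
    (c), and (c) gives (a) together with the last formula, by the identity
    (y - x)^2 = y^2 - x^2 - 2 x (y - x) summed over a partition ([LC_qvar]).

    The limit theorem ([trace_sum_cvg]) is an induction on intervals
    ([interval_induction]): an estimate that is additive in the interval holds on
    [s, t] as soon as it holds on small intervals with an endpoint at x, for each x.
    On such an interval f is close to one of its one-sided limits, apart from its
    value at x. So the term adjacent to x produces the jump of f at x, and the
    others add up to nearly h(f(x+)) or h(f(x-)) times what remains of the increment
    of V. The expected limit obeys the same local estimates
    ([ito_correction_right], [ito_correction_left]). Additivity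
    ([trace_sum_additive]) is where the right jumps of f have to be at partition
    points.

    To make sense of the expected limit, the same induction shows that the jumps
    of V sum up to at most its increment ([partial_sum_jumps_le]), so that the
    continuous part of V is indeed continuous and nondecreasing, and that a
    regulated function has a Riemann-Stieltjes integral with respect to it
    ([RS_exists]). *)

Set Implicit Arguments.
Unset Strict Implicit.
Unset Printing Implicit Defensive.

Import Order.TTheory GRing.Theory Num.Theory.
Import numFieldNormedType.Exports.

Local Open Scope classical_set_scope.
Local Open Scope ring_scope.

(** * Induction on intervals and one-sided limits *)

Section OneSided.
Variable R : realType.
Implicit Types (a b s t u v w x y : R) (f g h : R -> R).

Lemma near_rightE x (P : R -> Prop) :
  (\forall y \near x^'+, P y) <->
  exists2 d, 0 < d & forall y, x < y -> y < x + d -> P y.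
Proof.
split=> [[d /= d0 H]|[d d0 H]].
  exists d => // y xy yd; apply: H => //=.
  by rewrite /ball_ /= ltr_norml; apply/andP; split; lra.
exists d => //= y; rewrite /ball_ /= ltr_norml => /andP[? ?] xy; apply: H => //; lra.
Qed.

Lemma near_leftE x (P : R -> Prop) :
  (\forall y \near x^'-, P y) <->
  exists2 d, 0 < d & forall y, x - d < y -> y < x -> P y.
Proof.
split=> [[d /= d0 H]|[d d0 H]].
  exists d => // y xy yd; apply: H => //=.
  by rewrite /ball_ /= ltr_norml; apply/andP; split; lra.
exists d => //= y; rewrite /ball_ /= ltr_norml => /andP[? ?] xy; apply: H => //; lra.
Qed.

(** The supremum of the right endpoints that can be reached from s is itself
    reached, by the property on its left, and can be passed unless it is t, by
    the property on its right. This replaces, throughout, the choice of a finite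
    partition adapted to the oscillations of a regulated function: an additive
    estimate on [s, t] only has to be checked on one-sided neighbourhoods, where
    a regulated function is close to a constant. *)
Lemma interval_induction (P : R -> R -> Prop) s t : s < t ->
  (forall u v w, s <= u -> u < v -> v < w -> w <= t ->
     P u v -> P v w -> P u w) ->
  (forall x, s <= x -> x < t -> \forall v \near x^'+, P x v) ->
  (forall x, s < x -> x <= t -> \forall u \near x^'-, P u x) ->
  P s t.
Proof.
move=> st Padd Pr Pl.
pose S := [set x | [/\ s < x, x <= t & P s x]].
have /near_rightE[d d0 Hd] := Pr s (lexx s) st.
have [x0 [sx0 x0t Px0]] : exists x, S x.
  exists (Num.min t (s + d / 2)); split.
  - by rewrite lt_min st /=; lra.
  - by rewrite ge_min lexx.
  - by apply: Hd; rewrite ?lt_min ?gt_min ?st /=; try (apply/orP; right); lra.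
have ubS : ubound S t by move=> x [].
have supS : has_sup S by split; [exists x0 | exists t].
pose c := sup S.
have sc : s < c by apply: (lt_le_trans sx0); apply: ub_le_sup => //; exists t.
have ct : c <= t by apply: ge_sup => //; exists x0.
have Pc : P s c.
  have /near_leftE[e e0 He] := Pl c sc ct.
  have [y Sy cy] := sup_adherent e0 supS; have [sy yt Py] := Sy.
  have := ub_le_sup supS.2 Sy; rewrite le_eqVlt => /predU1P[yc|yc].
    by move: Py; rewrite yc.
  by apply: (Padd s y c) => //; apply: He.
move: ct; rewrite le_eqVlt => /predU1P[<-//|ct].
have /near_rightE[e e0 He] := Pr c (ltW sc) ct.
pose v := Num.min t (c + e / 2).
have cv : c < v by rewrite lt_min ct /=; lra.
have vt : v <= t by rewrite ge_min lexx.
have vce : v < c + e by rewrite gt_min; apply/orP; right; lra.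
have Sv : S v by split=> //; [exact: lt_trans cv | apply: (Padd s c v) => //; exact: He].
by have := ub_le_sup supS.2 Sv; rewrite leNgt cv.
Qed.

Lemma leftlim_cvg a b f t : regulated a b f -> a < t -> t <= b ->
  f x @[x --> t^'-] --> leftlim f t.
Proof. by case=> H _ at_ tb; apply: H; rewrite in_itv /= at_ tb. Qed.

Lemma rightlim_cvg a b f s : regulated a b f -> a <= s -> s < b ->
  f x @[x --> s^'+] --> rightlim f s.
Proof. by case=> _ H at_ tb; apply: H; rewrite in_itv /= at_ tb. Qed.

Lemma leftlimP f t l : f x @[x --> t^'-] --> l -> leftlim f t = l.
Proof. exact: cvg_lim. Qed.

Lemma rightlimP f t l : f x @[x --> t^'+] --> l -> rightlim f t = l.
Proof. exact: cvg_lim. Qed.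

Lemma regulated_comp a b psi f : continuous psi -> regulated a b f ->
  regulated a b (psi \o f).
Proof.
move=> cpsi [fl fr]; split=> t tI; apply/cvg_ex.
  exists (psi (leftlim f t)); apply: continuous_cvg; [exact: cpsi|exact: fl].
exists (psi (rightlim f t)); apply: continuous_cvg; [exact: cpsi|exact: fr].
Qed.

Lemma leftlim_comp a b psi f t : continuous psi -> regulated a b f ->
  a < t -> t <= b -> leftlim (psi \o f) t = psi (leftlim f t).
Proof.
move=> cpsi fr at_ tb; apply: leftlimP; apply: continuous_cvg; first exact: cpsi.
exact: leftlim_cvg fr at_ tb.
Qed.

Lemma rightlim_comp a b psi f t : continuous psi -> regulated a b f ->
  a <= t -> t < b -> rightlim (psi \o f) t = psi (rightlim f t).
Proof.
move=> cpsi fr at_ tb; apply: rightlimP; apply: continuous_cvg; first exact: cpsi.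
exact: rightlim_cvg fr at_ tb.
Qed.

Lemma regulated_bounded a b f : a < b -> regulated a b f ->
  exists2 M, 0 < M & forall x, a <= x -> x <= b -> `|f x| <= M.
Proof.
move=> ab fr.
apply: (@interval_induction (fun u v => exists2 M, 0 < M &
  forall x, u <= x -> x <= v -> `|f x| <= M) _ _ ab).
- move=> u v w _ _ _ _ [M M0 HM] [N N0 HN].
  exists (Num.max M N); first by rewrite lt_max M0.
  move=> x ux xw; rewrite le_max; apply/orP.
  by case: (leP x v) => xv; [left; exact: HM | right; exact/HN/xw/ltW].
- move=> x ax xb; have /cvgrPdist_lt/(_ 1 ltr01)/near_rightE[d d0 Hd] :=
    rightlim_cvg fr ax xb.
  apply/near_rightE; exists d => // v xv vd.
  exists (Num.max (`|f x|+1) (`|rightlim f x| + 1)).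
    by rewrite lt_max; apply/orP; left; apply: ltr_wpDl.
  move=> y; rewrite le_eqVlt => /predU1P[<- _|xy yv].
    by rewrite le_max; apply/orP; left; lra.
  rewrite le_max; apply/orP; right.
  have := Hd y xy (le_lt_trans yv vd).
  by rewrite distrC => /ltW; have := ler_normD (f y - rightlim f x) (rightlim f x);
     rewrite subrK; lra.
- move=> x ax xb; have /cvgrPdist_lt/(_ 1 ltr01)/near_leftE[d d0 Hd] :=
    leftlim_cvg fr ax xb.
  apply/near_leftE; exists d => // v xv vd.
  exists (Num.max (`|f x|+1) (`|leftlim f x| + 1)).
    by rewrite lt_max; apply/orP; left; apply: ltr_wpDl.
  move=> y vy; rewrite le_eqVlt => /predU1P[->|xy].
    by rewrite le_max; apply/orP; left; lra.
  rewrite le_max; apply/orP; right.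
  have := Hd y (lt_le_trans xv vy) xy.
  by rewrite distrC => /ltW; have := ler_normD (f y - leftlim f x) (leftlim f x);
     rewrite subrK; lra.
Qed.

End OneSided.

(** * Sums over the traces of a refining sequence of partitions *)

Section PartitionSums.
Variable R : realType.
Implicit Types (s t u v w x y : R) (p q : seq R) (F Q : R -> R -> R).

Lemma partition_sum_nil F s : partition_sum F s [::] = 0.
Proof. by rewrite /partition_sum big_nil. Qed.

Lemma partition_sum_cons F s x p :
  partition_sum F s (x :: p) = F s x + partition_sum F x p.
Proof.
rewrite /partition_sum /= big_nat_recl //=; congr (_ + _).
rewrite !big_nat; apply: eq_bigr => i /andP[_ ip].
by congr F; apply: set_nth_default => //=; rewrite ltnS ltnW.
Qed.

Lemma partition_sum_cat F s p q :
  partition_sum F s (p ++ q) = partition_sum F s p + partition_sum F (last s p) q.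
Proof.
elim: p s => [|x p IH] s /=; first by rewrite partition_sum_nil add0r.
by rewrite !partition_sum_cons IH addrA.
Qed.

Lemma partition_sum_rcons F s p t :
  partition_sum F s (rcons p t) = partition_sum F s p + F (last s p) t.
Proof.
by rewrite -cats1 partition_sum_cat partition_sum_cons partition_sum_nil addr0.
Qed.

Lemma partition_sum_dist F Q (A : R -> Prop) (c e : R) s p :
  (forall x y, A x -> A y -> `|F x y - c * Q x y| <= e * Q x y) ->
  (forall x, x \in s :: p -> A x) ->
  `|partition_sum F s p - c * partition_sum Q s p| <= e * partition_sum Q s p.
Proof.
move=> FQ; elim: p s => [|x p IH] s Ap.
  by rewrite !partition_sum_nil !mulr0 subr0 normr0.
rewrite !partition_sum_cons !mulrDr opprD addrACA.
apply: (le_trans (ler_normD _ _)); apply: lerD.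
  by apply: FQ; apply: Ap; rewrite !inE eqxx ?orbT.
by apply: IH => y yp; apply: Ap; rewrite inE yp orbT.
Qed.

Lemma partition_sum_telescope F (g : R -> R) s p :
  partition_sum (fun x y => g y - g x + F x y) s p =
  g (last s p) - g s + partition_sum F s p.
Proof.
elim: p s => [|x p IH] s /=; first by rewrite !partition_sum_nil subrr addr0.
by rewrite !partition_sum_cons IH; ring.
Qed.

Lemma partition_sumZ F (c : R) s p :
  partition_sum (fun x y => c * F x y) s p = c * partition_sum F s p.
Proof.
elim: p s => [|x p IH] s /=; first by rewrite !partition_sum_nil mulr0.
by rewrite !partition_sum_cons IH mulrDr.
Qed.

Lemma eq_partition_sum F Q s p : (forall x y, F x y = Q x y) ->
  partition_sum F s p = partition_sum Q s p.
Proof. by move=> FQ; rewrite /partition_sum; apply: eq_bigr => i _. Qed.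

Lemma partition_sum_ge0 F s p : (forall x y, 0 <= F x y) ->
  0 <= partition_sum F s p.
Proof. by move=> F0; rewrite /partition_sum; apply: sumr_ge0. Qed.

Lemma last_trace_partition (lam : nat -> seq R) s t m :
  last s (trace_partition lam s t m) = t.
Proof. by rewrite last_rcons. Qed.

(** The neighbours of v in the traces of a partition on [u, v] and on [v, w]; the
    defaults u and w are the far endpoints of these traces. *)
Definition prevpt (lam : nat -> seq R) u v m : R :=
  last u [seq x <- lam m | u < x < v].
Definition nextpt (lam : nat -> seq R) v w m : R :=
  head w [seq x <- lam m | v < x < w].

Lemma trace_sum_last F (lam : nat -> seq R) u v m :
  partition_sum F u (trace_partition lam u v m) =
  partition_sum F u [seq x <- lam m | u < x < v] + F (prevpt lam u v m) v.
Proof. exact: partition_sum_rcons. Qed.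

Lemma trace_sum_head F (lam : nat -> seq R) u v m :
  partition_sum F u (trace_partition lam u v m) =
  F u (nextpt lam u v m) +
  partition_sum F (nextpt lam u v m) (behead (trace_partition lam u v m)).
Proof.
rewrite /trace_partition /nextpt; case: [seq x <- lam m | u < x < v] => [|y p] /=;
by rewrite partition_sum_cons.
Qed.

Lemma mem_trace_head (lam : nat -> seq R) u v m x : u < v ->
  x \in nextpt lam u v m :: behead (trace_partition lam u v m) -> u < x <= v.
Proof.
move=> uv.
have H : all [pred x | u < x <= v] (trace_partition lam u v m).
  rewrite all_rcons /= uv lexx /=; apply/allP => y.
  by rewrite mem_filter => /andP[/andP[uy /ltW yv] _] /=; rewrite uy.
suff -> : nextpt lam u v m :: behead (trace_partition lam u v m) =
  trace_partition lam u v m by move=> xT; exact: (allP H _ xT).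
by rewrite /trace_partition /nextpt; case: [seq x <- lam m | u < x < v].
Qed.

Lemma mem_trace_last (lam : nat -> seq R) u v m x : u < v ->
  x \in u :: [seq x <- lam m | u < x < v] -> u <= x < v.
Proof.
rewrite inE mem_filter => uv /predU1P[->|/andP[/andP[/ltW -> ->] //]].
by rewrite lexx uv.
Qed.

Lemma sorted_filter_split (s : seq R) u v w : sorted <%R s -> u < v -> v < w ->
  [seq x <- s | u < x < w] =
  [seq x <- s | u < x < v] ++ [seq x <- s | x == v] ++ [seq x <- s | v < x < w].
Proof.
move=> + uv vw; elim: s => // x s IH /= xs.
have {}IH := IH (path_sorted xs).
have xlt := order_path_min lt_trans xs.
have nil (P : pred R) : (forall y, x < y -> P y = false) -> [seq y <- s | P y] = [::].
  move=> PF; apply/eqP; rewrite -(negbK (_ == _)) -has_filter; apply/hasPn => y ys.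
  by rewrite PF // (allP xlt).
case: (ltgtP x v) => xv.
- rewrite (lt_trans xv vw) !andbT /=.
  by case: ifP => _ //=; rewrite IH.
- rewrite (lt_trans uv xv) /=.
  rewrite (nil (fun y => u < y < v)) ?(nil (fun y => y == v)) /=; last 2 first.
  + by move=> y xy; rewrite gt_eqF // (lt_trans xv).
  + by move=> y xy; rewrite [y < v]lt_gtF ?andbF // (lt_trans xv).
  case: ifP => // _; [congr (_ :: _)|];
  by apply: eq_in_filter => y /(allP xlt) /= xy; rewrite (lt_trans xv xy)
     (lt_trans uv (lt_trans xv xy)).
- rewrite xv uv vw /=.
  rewrite (nil (fun y => u < y < v)) ?(nil (fun y => y == v)) /=; last 2 first.
  + by move=> y; rewrite xv => vy; rewrite gt_eqF.
  + by move=> y; rewrite xv => vy; rewrite [y < v]lt_gtF ?andbF.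
  congr (_ :: _); apply: eq_in_filter => y /(allP xlt) /=; rewrite xv => xy.
  by rewrite xy (lt_trans uv xy).
Qed.

Lemma trace_sum_split_mem F (lam : nat -> seq R) u v w m :
  sorted <%R (lam m) -> u < v -> v < w -> v \in lam m ->
  partition_sum F u (trace_partition lam u w m) =
  partition_sum F u (trace_partition lam u v m) +
  partition_sum F v (trace_partition lam v w m).
Proof.
move=> sl uv vw vl; rewrite /trace_partition (sorted_filter_split sl uv vw).
rewrite filter_pred1_uniq ?(sorted_uniq lt_trans ltxx) //=.
by rewrite rcons_cat /= partition_sum_cat partition_sum_cons (partition_sum_rcons _ u) addrA.
Qed.

(** The interval of the partition that straddles v is cut in two on the
    right-hand side; the last term undoes the cut. *)
Lemma trace_sum_split_notin F (lam : nat -> seq R) u v w m :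
  sorted <%R (lam m) -> u < v -> v < w -> v \notin lam m ->
  partition_sum F u (trace_partition lam u w m) =
  partition_sum F u (trace_partition lam u v m) +
  partition_sum F v (trace_partition lam v w m) +
  (F (prevpt lam u v m) (nextpt lam v w m)
   - F (prevpt lam u v m) v - F v (nextpt lam v w m)).
Proof.
move=> sl uv vw vl.
rewrite (trace_sum_last F lam u v) (trace_sum_head F lam v w).
rewrite {1}/trace_partition (sorted_filter_split sl uv vw).
have -> : [seq x <- lam m | x == v] = [::].
  apply/eqP; rewrite -(negbK (_ == _)) -has_filter; apply/hasPn => y ys.
  by apply/eqP => yv; rewrite -yv ys in vl.
rewrite /= rcons_cat partition_sum_cat.
have -> : rcons [seq x <- lam m | v < x < w] w =
  nextpt lam v w m :: behead (trace_partition lam v w m).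
  by rewrite /trace_partition /nextpt; case: [seq x <- lam m | v < x < w].
by rewrite partition_sum_cons /prevpt; ring.
Qed.

End PartitionSums.

Section Refining.
Variables (R : realType) (a b : R) (lam : nat -> seq R).
Hypothesis hlam : refining_partitions a b lam.
Implicit Types (u v w x y : R).

Lemma refining_sorted m : sorted <%R (lam m).
Proof. by have [/(_ m)[+ _] _ _] := hlam; exact: path_sorted. Qed.

Lemma refining_subset m n x : (m <= n)%N -> x \in lam m -> x \in lam n.
Proof.
have [_ sub _] := hlam => /subnK <-; elim: (n - m)%N => // k IH xm.
by rewrite addSn; apply: sub; exact: IH.
Qed.

Lemma partition_points_mem x : a < x -> partition_points a lam x ->
  exists m, x \in lam m.
Proof.
by move=> ax [m]; rewrite inE => /predU1P[xa|]; [rewrite xa ltxx in ax|exists m].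
Qed.

Lemma refining_dense u v : a <= u -> u < v -> v <= b ->
  exists y, [/\ u < y, y < v & \forall m \near \oo, y \in lam m].
Proof.
move=> au uv vb; have [_ _ dense] := hlam.
have /dense : `[a, b]%classic ((u + v) / 2) by rewrite /= in_itv /=; apply/andP; split; lra.
have uvn : nbhs ((u + v) / 2) `]u, v[%classic.
  by apply: near_in_itvoo; rewrite in_itv /=; apply/andP; split; lra.
move=> /(_ _ uvn)[y [yp]]; rewrite /= in_itv /= => /andP[uy yv].
have [m ym] := partition_points_mem (le_lt_trans au uy) yp.
exists y; split => //; exists m => // n /= mn; exact: refining_subset ym.
Qed.

(** Density puts a partition point as close to v as desired, and since the
    partitions are nested it stays there. *)
Lemma prevpt_cvg u v : a <= u -> u < v -> v <= b ->
  prevpt lam u v m @[m --> \oo] --> v^'-.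
Proof.
move=> au uv vb P /near_leftE[d d0 HP].
have [|||y [uy yv ylam]] := @refining_dense (Num.max u (v - d)) v.
- by rewrite le_max au.
- by rewrite gt_max uv /=; lra.
- exact: vb.
move: uy; rewrite gt_max => /andP[uy dy].
apply: filterS ylam => m ym; rewrite /prevpt.
set p := [seq x <- lam m | u < x < v].
have yp : y \in p by rewrite mem_filter uy yv.
have up : path <%R u p.
  rewrite path_min_sorted ?sorted_filter ?refining_sorted //; first exact: lt_trans.
  by apply/allP => x; rewrite mem_filter => /andP[/andP[]].
have /mem_trace_last-/(_ uv)/andP[_ lv] := mem_last u p.
have yl : y <= last u p.
  case/splitPr: yp up => p1 p2; rewrite cat_path /= => /and3P[_ _].
  move=> /(order_path_min lt_trans)/allP H; rewrite last_cat /=.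
  by have := mem_last y p2; rewrite inE => /predU1P[->//|/H/ltW].
by apply: HP => //; exact: lt_le_trans yl.
Qed.

Lemma nextpt_cvg v w : a <= v -> v < w -> w <= b ->
  nextpt lam v w m @[m --> \oo] --> v^'+.
Proof.
move=> av vw wb P /near_rightE[d d0 HP].
have [|||y [vy yw ylam]] := @refining_dense v (Num.min w (v + d)).
- exact: av.
- by rewrite lt_min vw /=; lra.
- by rewrite ge_min wb.
move: yw; rewrite lt_min => /andP[yw dy].
apply: filterS ylam => m ym; rewrite /preimage /nextpt /=.
set p := (X in head _ X).
have : y \in p by rewrite mem_filter vy yw.
have : sorted <%R p.
  by apply: sorted_filter; [exact: lt_trans|exact: refining_sorted].
have : all (fun x => v < x) p.
  by apply/allP => x; rewrite mem_filter => /andP[/andP[]].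
case: p => //= x p /andP[vx _] /(order_path_min lt_trans)/allP H.
rewrite inE => xy; apply: HP => //; apply: le_lt_trans dy.
by move: xy => /predU1P[->//|/H/ltW].
Qed.

End Refining.

(** * Unconditional sums *)

Section UnconditionalSums.
Variable R : realType.
Implicit Types (u w : R -> R) (D : set R) (c e l k : R) (A B : {fset R}).

#[local] Existing Instance totally_filter.

Notation psum u := (partial_sum u @ totally).

Lemma partial_sumE u A : partial_sum u A = \sum_(x <- A) u x.
Proof. by rewrite /partial_sum big_seq_fsetE. Qed.

Lemma partial_sumD u w A :
  partial_sum (fun x => u x + w x) A = partial_sum u A + partial_sum w A.
Proof. by rewrite /partial_sum big_split. Qed.

Lemma partial_sumZ c u A : partial_sum (fun x => c * u x) A = c * partial_sum u A.
Proof. by rewrite /partial_sum mulr_sumr. Qed.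

Lemma partial_sum_ge0 u A : (forall x, 0 <= u x) -> 0 <= partial_sum u A.
Proof. by move=> u0; apply: sumr_ge0. Qed.

Lemma ler_partial_sum u w A : (forall x, u x <= w x) ->
  partial_sum u A <= partial_sum w A.
Proof. by move=> uw; apply: ler_sum. Qed.

Lemma partial_sum_subset u A B : (forall x, 0 <= u x) -> (A `<=` B)%fset ->
  partial_sum u A <= partial_sum u B.
Proof.
move=> u0 AB; rewrite !partial_sumE (big_fsetID _ (mem A) B) /=.
have -> : [fset x in B | x \in A]%fset = A.
  by apply/fsetP => x; rewrite !inE /= andbC; apply: andb_idr => /(fsubsetP AB).
by rewrite lerDl; apply: sumr_ge0.
Qed.

Lemma psumD u w l k : psum u --> l -> psum w --> k ->
  psum (fun x => u x + w x) --> l + k.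
Proof.
move=> ul wk; rewrite (_ : partial_sum _ = partial_sum u \+ partial_sum w).
  exact: cvgD.
by apply/funext => A; rewrite partial_sumD.
Qed.

Lemma psumZ c u l : psum u --> l -> psum (fun x => c * u x) --> c * l.
Proof.
move=> ul; rewrite (_ : partial_sum _ = (fun A => c * partial_sum u A)).
  exact: cvgMr.
by apply/funext => A; rewrite partial_sumZ.
Qed.

Lemma psumB u w l k : psum u --> l -> psum w --> k ->
  psum (fun x => u x - w x) --> l - k.
Proof.
move=> ul wk; rewrite -mulN1r.
rewrite (_ : (fun x => _) = (fun x => u x + -1 * w x)).
  by apply: psumD => //; exact: psumZ.
by apply/funext => x; rewrite mulN1r.
Qed.

Lemma psum_ge0_cvg w c : (forall x, 0 <= w x) ->
  (forall A, partial_sum w A <= c) -> cvg (psum w).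
Proof.
move=> w0 wc; apply/cvg_ex; exists (sup (range (partial_sum w))).
have hs : has_sup (range (partial_sum w)).
  by split; [exists (partial_sum w fset0), fset0|exists c => _ [A _ <-]].
apply/cvgrPdist_lt => e e0.
have [_ [A _ <-] lA] := sup_adherent e0 hs.
exists A => // B /= AB; have lAB := partial_sum_subset w0 AB.
have lB : partial_sum w B <= sup (range (partial_sum w)).
  by apply: ub_le_sup; [exact: hs.2|exists B].
by rewrite ger0_norm; lra.
Qed.

(** u + w is nonnegative and its partial sums are at most twice the sum of w, so
    u is a difference of two families with convergent sums. *)
Lemma psum_dominated_cvg u w : (forall x, `|u x| <= w x) -> cvg (psum w) ->
  cvg (psum u).
Proof.
move=> uw /cvg_ex[l wl].
have w0 x : 0 <= w x by exact: le_trans (normr_ge0 _) (uw x).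
have uw0 x : 0 <= u x + w x by have := uw x; rewrite ler_norml; lra.
have wle A : partial_sum w A <= l.
  apply: (cvgr_to_ge wl); exists A => // B /= AB; exact: partial_sum_subset.
have /cvg_ex[k ck] : cvg (psum (fun x => u x + w x)).
  apply: (@psum_ge0_cvg _ (2 * l)) => // A.
  apply: (@le_trans _ _ (2 * partial_sum w A)); last by rewrite ler_pM2l.
  by rewrite -partial_sumZ; apply: ler_partial_sum => x; have := uw x; rewrite ler_norml; lra.
apply/cvg_ex; exists (k - l).
rewrite (_ : u = (fun x => u x + w x - w x)); first exact: psumB.
by apply/funext => x; rewrite addrK.
Qed.

Lemma psum_dist u w l k c e : psum u --> l -> psum w --> k ->
  (forall x, `|u x - c * w x| <= e * w x) -> `|l - c * k| <= e * k.
Proof.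
move=> ul wk uw; rewrite -subr_ge0.
apply: (@cvgr_to_ge _ totally _ _ (fun A => e * partial_sum w A -
  `|partial_sum u A - c * partial_sum w A|)).
  apply: cvgB; first exact: cvgMr.
  by apply: cvg_norm; apply: cvgB => //; exact: cvgMr.
apply: nearW => A; rewrite subr_ge0 -!partial_sumZ /partial_sum -sumrB.
by apply: (le_trans (ler_norm_sum _ _ _)); exact: ler_sum.
Qed.

Lemma usumP D u : usummable D u -> psum (u \_ D) --> usum D u.
Proof. by []. Qed.

Lemma usumE D u l : psum (u \_ D) --> l -> usum D u = l.
Proof. exact: cvg_lim. Qed.

Lemma usum_dist D u w c e : usummable D u -> usummable D w ->
  (forall y, D y -> `|u y - c * w y| <= e * w y) ->
  `|usum D u - c * usum D w| <= e * usum D w.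
Proof.
move=> uD wD H; apply: (psum_dist (usumP uD) (usumP wD)) => x.
rewrite /patch; case: ifPn => [/set_mem/H//|_].
by rewrite !mulr0 subr0 normr0.
Qed.

Lemma psum_point x (k : R) : psum (fun y : R => if y == x then k else 0) --> k.
Proof.
apply/cvgrPdist_lt => e e0; exists ([fset x]%fset : {fset R}) => // A /=.
rewrite fsub1set => xA; rewrite partial_sumE (big_fsetD1 x) /= ?eqxx //.
rewrite big_seq big1 ?addr0 ?subrr ?normr0 // => y.
by rewrite !inE => /andP[/negbTE ->].
Qed.

(** For jump sums over a small interval that contains its endpoint x: all the
    jumps but the one at x are small. *)
Lemma usum_punctured_dist D u w x c e : usummable D u -> usummable D w -> D x ->
  (forall y, D y -> y != x -> `|u y - c * w y| <= e * w y) ->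
  `|usum D u - u x - c * (usum D w - w x)| <= e * (usum D w - w x).
Proof.
move=> uD wD Dx H; apply: (psum_dist
  (psumB (usumP uD) (@psum_point x (u x)))
  (psumB (usumP wD) (@psum_point x (w x)))) => y /=.
rewrite /patch; case: (eqVneq y x) => [->|yx].
  by rewrite mem_set // !subrr !mulr0 subr0 normr0.
rewrite !subr0; case: ifPn => [/set_mem/H/(_ yx)//|_].
by rewrite !mulr0 subr0 normr0.
Qed.

Lemma usummable_dominated D (E : set R) u w c : (forall y, D y -> E y) ->
  (forall y, 0 <= w y) -> (forall y, D y -> `|u y| <= c * w y) -> 0 <= c ->
  usummable E w -> usummable D u.
Proof.
move=> DE w0 uw c0 /usumP/(@psumZ c) wE.
apply: (psum_dominated_cvg _ (cvgP _ wE)) => x.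
rewrite /patch; case: ifPn => [/set_mem Dx|_].
  by rewrite mem_set ?uw //; exact: DE.
by rewrite normr0 mulr_ge0 //; case: ifP.
Qed.

Lemma usum_split D D1 D2 u : (forall x, (u \_ D) x = (u \_ D1) x + (u \_ D2) x) ->
  usummable D1 u -> usummable D2 u -> usum D u = usum D1 u + usum D2 u.
Proof.
move=> E u1 u2; apply: usumE.
rewrite (_ : u \_ D = (fun x => (u \_ D1) x + (u \_ D2) x)).
  by apply: psumD; exact: usumP.
exact/funext.
Qed.

(** A joint bound, because the left jumps and the right jumps of the bracket
    share its total increment. *)
Lemma usum_pair_bound D (E : set R) u w c : (forall x, 0 <= u x) -> (forall x, 0 <= w x) ->
  (forall A, partial_sum (u \_ D) A + partial_sum (w \_ E) A <= c) ->
  [/\ usummable D u, usummable E w & usum D u + usum E w <= c].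
Proof.
move=> u0 w0 H.
have pu0 x : 0 <= (u \_ D) x by rewrite /patch; case: ifP.
have pw0 x : 0 <= (w \_ E) x by rewrite /patch; case: ifP.
have uD : usummable D u.
  apply: (@psum_ge0_cvg _ c) => // A; apply: le_trans (H A).
  by rewrite lerDl partial_sum_ge0.
have wE : usummable E w.
  apply: (@psum_ge0_cvg _ c) => // A; apply: le_trans (H A).
  by rewrite lerDr partial_sum_ge0.
split => //; apply: (cvgr_to_le (psumD (usumP uD) (usumP wE))).
by apply: nearW => A; rewrite partial_sumD.
Qed.

Lemma usum_ge0 D u : (forall x, 0 <= u x) -> usummable D u -> 0 <= usum D u.
Proof.
move=> u0 uD; apply: (cvgr_to_ge (usumP uD)); apply: nearW => A.
by apply: partial_sum_ge0 => x; rewrite /patch; case: ifP.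
Qed.

Lemma usum_ge_point D u x : (forall x, 0 <= u x) -> usummable D u -> D x ->
  u x <= usum D u.
Proof.
move=> u0 uD Dx; rewrite -subr_ge0.
apply: (cvgr_to_ge (psumB (usumP uD) (@psum_point x (u x)))); apply: nearW => A.
apply: partial_sum_ge0 => y; case: eqP => [->|_].
  by rewrite /patch mem_set // subrr.
by rewrite subr0 /patch; case: ifP.
Qed.

Lemma patch_itvoc_split u x y z v : x <= y -> y <= z ->
  (u \_ `]x, z]) v = (u \_ `]x, y]) v + (u \_ `]y, z]) v.
Proof.
move=> xy yz; rewrite /patch !mem_setE !in_itv /=.
case: (leP v y) => vy; last by rewrite (le_lt_trans xy vy) /= add0r.
by rewrite (le_trans vy yz) addr0.
Qed.

Lemma patch_itvco_split u x y z v : x <= y -> y <= z ->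
  (u \_ `[x, z[) v = (u \_ `[x, y[) v + (u \_ `[y, z[) v.
Proof.
move=> xy yz; rewrite /patch !mem_setE !in_itv /=.
case: (ltP v y) => vy; last by rewrite (le_trans xy vy) /= add0r.
by rewrite (lt_le_trans vy yz) addr0.
Qed.

Lemma usum_itvoc_split u x y z : x <= y -> y <= z ->
  usummable `]x, y] u -> usummable `]y, z] u ->
  usum `]x, z] u = usum `]x, y] u + usum `]y, z] u.
Proof.
by move=> xy yz; apply: usum_split => v; exact: patch_itvoc_split.
Qed.

Lemma usum_itvco_split u x y z : x <= y -> y <= z ->
  usummable `[x, y[ u -> usummable `[y, z[ u ->
  usum `[x, z[ u = usum `[x, y[ u + usum `[y, z[ u.
Proof.
by move=> xy yz; apply: usum_split => v; exact: patch_itvco_split.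
Qed.

End UnconditionalSums.

(** * Riemann-Stieltjes integrals with a continuous monotone integrator *)

Section RiemannStieltjes.
Variable R : realType.
Implicit Types (s t u v w x y c d e M K I : R) (h G : R -> R) (l : seq (R * R)).

(** A tagged partition of [u, v] of mesh less than d is encoded by the list of
    its pairs (right endpoint, tag), which can be concatenated and cut by
    induction, in contrast with tags indexed by positions. *)
Fixpoint tagged d u l v : bool :=
  if l is p :: l' then
    [&& u < p.1, p.1 - u < d, u <= p.2 <= p.1 & tagged d p.1 l' v]
  else u == v.

Fixpoint tagged_sum h G u l : R :=
  if l is p :: l' then h p.2 * (G p.1 - G u) + tagged_sum h G p.1 l' else 0.

(** All indices are in range, so that z is arbitrary; keeping the same default
    for all the sublists makes the induction possible. *)
Lemma taggedE z d s l t : tagged d s l t <->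
  itv_partition s t (unzip1 l) /\
  forall i, (i < size l)%N ->
    nth z (unzip1 l) i - nth z (s :: unzip1 l) i < d /\
    nth z (s :: unzip1 l) i <= nth z (unzip2 l) i <= nth z (unzip1 l) i.
Proof.
elim: l s => [|[x xi] l IH] s /=.
  by split=> [/eqP ->|[[_ /= ->]]//]; split => //; split => /=.
split=> [/and4P[sx xd sxi /IH[[pl lt] H]]|[[/= /andP[sx pl] lt] H]].
  by split; [split; rewrite /= ?sx|case=> [|i] //=; rewrite ltnS => /H].
rewrite sx /=; have [-> -> /=] := H 0%N erefl.
by apply/IH; split => // i il; exact: (H i.+1).
Qed.

Lemma tagged_sumE z h G s l : tagged_sum h G s l =
  \sum_(0 <= i < size l) h (nth z (unzip2 l) i) *
     (G (nth z (unzip1 l) i) - G (nth z (s :: unzip1 l) i)).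
Proof.
elim: l s => [|[x xi] l IH] s /=; first by rewrite big_nil.
by rewrite big_nat_recl //= -IH.
Qed.

Lemma is_RSP h G s t I : is_RS h G s t I <->
  forall e, 0 < e -> exists2 d, 0 < d &
    forall l, tagged d s l t -> `|tagged_sum h G s l - I| < e.
Proof.
split=> H e e0; have [d d0 Hd] := H e e0; exists d => //.
  move=> l /(taggedE s)[pst Hl].
  have := Hd (unzip1 l) (nth s (unzip2 l)) pst; rewrite size_map (tagged_sumE s).
  exact.
move=> p xi pst Hp; pose l := zip p (mkseq xi (size p)).
have lp : unzip1 l = p by rewrite unzip1_zip // size_mkseq.
have lx : unzip2 l = mkseq xi (size p) by rewrite unzip2_zip // size_mkseq.
have sl : size l = size p by rewrite -[in RHS]lp size_map.
have := Hd l; rewrite (tagged_sumE s) sl lp lx.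
rewrite (@eq_big_nat _ _ _ 0%N (size p) _
  (fun i => h (xi i) * (G (nth s p i) - G (nth s (s :: p) i)))).
  apply; apply/(taggedE s); rewrite lp lx sl; split => // i ip.
  by rewrite nth_mkseq //; exact: Hp.
by move=> i /andP[_ ip]; rewrite nth_mkseq.
Qed.

Lemma tagged_cat d u v w l1 l2 : tagged d u l1 v -> tagged d v l2 w ->
  tagged d u (l1 ++ l2) w.
Proof.
elim: l1 u => [|[x xi] l IH] u /=; first by move=> /eqP ->.
by move=> /and4P[-> -> -> /IH/[apply]].
Qed.

Lemma tagged_sum_cat h G d u v l1 l2 : tagged d u l1 v ->
  tagged_sum h G u (l1 ++ l2) = tagged_sum h G u l1 + tagged_sum h G v l2.
Proof.
elim: l1 u => [|[x xi] l IH] u /=; first by move=> /eqP ->; rewrite add0r.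
by move=> /and4P[_ _ _ /IH ->]; rewrite addrA.
Qed.

Lemma tagged_le d u l v : tagged d u l v -> u <= v.
Proof.
elim: l u => [|[x xi] l IH] u /=; first by move=> /eqP ->.
by move=> /and4P[/ltW ux _ _ /IH]; exact: le_trans.
Qed.

Lemma tagged_mesh d d' u l v : d <= d' -> tagged d u l v -> tagged d' u l v.
Proof.
move=> dd; elim: l u => [|[x xi] l IH] u //=.
by move=> /and4P[-> ud -> /IH ->]; rewrite (lt_le_trans ud dd).
Qed.

(** The tags avoid s because near s a regulated integrand is controlled by its
    right limit only at points different from s. *)
Lemma exists_tagged_right d s t : s < t -> 0 < d ->
  exists2 l, tagged d s l t & all (fun p => s < p.2 <= t) l.
Proof.
move=> st d0; apply: (@interval_induction R (fun s t => exists2 l, tagged d s l t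
  & all (fun p => s < p.2 <= t) l) _ _ st).
- move=> u v w _ uv vw _ [l1 t1 a1] [l2 t2 a2].
  exists (l1 ++ l2); first exact: tagged_cat t2.
  rewrite all_cat; apply/andP; split.
    by apply: sub_all a1 => p /andP[-> pv] /=; rewrite (le_trans pv (ltW vw)).
  by apply: sub_all a2 => p /andP[vp ->]; rewrite (lt_trans uv vp).
- move=> x _ _; apply/near_rightE; exists d => // v xv vd.
  by exists [:: (v, v)] => /=; rewrite ?xv ?lexx ?eqxx ?(ltW xv) //= andbT; lra.
- move=> x _ _; apply/near_leftE; exists d => // v xv vd.
  by exists [:: (x, x)] => /=; rewrite ?vd ?lexx ?eqxx ?(ltW vd) //= andbT; lra.
Qed.

Lemma exists_tagged_left d s t : s < t -> 0 < d ->
  exists2 l, tagged d s l t & all (fun p => s <= p.2 < t) l.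
Proof.
move=> st d0; apply: (@interval_induction R (fun s t => exists2 l, tagged d s l t
  & all (fun p => s <= p.2 < t) l) _ _ st).
- move=> u v w _ uv vw _ [l1 t1 a1] [l2 t2 a2].
  exists (l1 ++ l2); first exact: tagged_cat t2.
  rewrite all_cat; apply/andP; split.
    by apply: sub_all a1 => p /andP[-> pv] /=; rewrite (lt_trans pv vw).
  by apply: sub_all a2 => p /andP[vp ->]; rewrite (le_trans (ltW uv) vp).
- move=> x _ _; apply/near_rightE; exists d => // v xv vd.
  by exists [:: (v, x)] => /=; rewrite ?xv ?lexx ?eqxx ?(ltW xv) //= andbT; lra.
- move=> x _ _; apply/near_leftE; exists d => // v xv vd.
  by exists [:: (x, v)] => /=; rewrite ?vd ?lexx ?eqxx ?(ltW vd) //= andbT; lra.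
Qed.

Lemma RS_intP h G s t : RS_integrable h G s t -> is_RS h G s t (RS_int h G s t).
Proof. by case=> I HI; exact: (xgetI 0 (P := [set I | is_RS h G s t I]) HI). Qed.

Lemma RS_int_split h G s m t : s < m -> m < t -> RS_integrable h G s m ->
  RS_integrable h G m t -> RS_integrable h G s t ->
  RS_int h G s t = RS_int h G s m + RS_int h G m t.
Proof.
move=> sm mt /RS_intP/is_RSP H1 /RS_intP/is_RSP H2 /RS_intP/is_RSP H.
apply/eqP; rewrite -subr_eq0 -normr_le0.
apply/ler_addgt0Pr => e e0; rewrite add0r.
have e30 : 0 < e / 3 by rewrite divr_gt0.
have [d d0 Hd] := H _ e30; have [d1 d10 Hd1] := H1 _ e30.
have [d2 d20 Hd2] := H2 _ e30.
pose d' := Num.min d (Num.min d1 d2).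
have d'0 : 0 < d' by rewrite !lt_min d0 d10.
have d'd : d' <= d by rewrite ge_min lexx.
have d'd1 : d' <= d1 by rewrite !ge_min lexx orbT.
have d'd2 : d' <= d2 by rewrite !ge_min lexx !orbT.
have [l1 t1 _] := exists_tagged_right sm d'0.
have [l2 t2 _] := exists_tagged_right mt d'0.
have := Hd _ (tagged_mesh d'd (tagged_cat t1 t2)).
have := Hd1 _ (tagged_mesh d'd1 t1); have := Hd2 _ (tagged_mesh d'd2 t2).
rewrite (tagged_sum_cat _ _ _ t1).
rewrite !ltr_norml => /andP[? ?] /andP[? ?] /andP[? ?].
by rewrite ler_norml; apply/andP; split; lra.
Qed.

Section Monotone.
Variables (s t : R) (h G : R -> R).
Hypothesis (Gmono : forall x y, s <= x -> x <= y -> y <= t -> G x <= G y).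

Lemma tagged_sum_dist d u v l c e : s <= u -> v <= t -> tagged d u l v ->
  all (fun p => `|h p.2 - c| <= e) l ->
  `|tagged_sum h G u l - c * (G v - G u)| <= e * (G v - G u).
Proof.
move=> + vt; elim: l u => [|[x xi] l IH] u su /=.
  by move=> /eqP -> _; rewrite !subrr !mulr0 subr0 normr0.
move=> /and4P[ux _ _ tl] /andP[hxi al].
have sx : s <= x by rewrite (le_trans su) // ltW.
have := IH _ sx tl al.
have Gux : 0 <= G x - G u.
  by rewrite subr_ge0 Gmono // ?(ltW ux) // (le_trans (tagged_le tl)).
have : `|(h xi - c) * (G x - G u)| <= e * (G x - G u).
  by rewrite normrM (ger0_norm Gux) ler_wpM2r.
rewrite !ler_norml => /andP[? ?] /andP[? ?].
by apply/andP; split; nra.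
Qed.

(** Only the last tag can be v, where h may be far from its left limit; this
    costs K times the increment of G over one interval, hence nothing in the limit
    when G is continuous at v. *)
Lemma tagged_sum_dist_last d u v l c e K : 0 < d -> s <= u -> v <= t ->
  0 <= K -> tagged d u l v ->
  (forall x, u <= x -> x < v -> `|h x - c| <= e) -> `|h v - c| <= e + K ->
  exists z, [/\ u <= z, z <= v, v - z < d &
  `|tagged_sum h G u l - c * (G v - G u)| <= e * (G v - G u) + K * (G v - G z)].
Proof.
move=> d0 + vt K0; elim: l u => [|[x xi] l IH] u su /=.
  move=> /eqP -> _ _; exists v; rewrite !subrr !mulr0 subr0 normr0 addr0.
  by split.
move=> /and4P[ux xd /andP[uxi xix] tl] H hv.
have sx : s <= x by rewrite (le_trans su) // ltW.
have xv := tagged_le tl.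
have Gux : 0 <= G x - G u by rewrite subr_ge0 Gmono // ?(ltW ux) // (le_trans xv).
have := xv; rewrite le_eqVlt => /predU1P[xE|xv'].
  subst x; case: l tl {IH} => [_|p l /=]; last first.
    by move=> /and4P[vp _ _ /tagged_le]; rewrite leNgt vp.
  exists u; rewrite lexx (ltW ux) xd addr0 -mulrBl normrM (ger0_norm Gux) -mulrDl.
  split => //; rewrite ler_wpM2r //.
  case: (ltP xi v) => xiv; last by rewrite (_ : xi = v) //; apply/eqP; rewrite eq_le xix.
  by rewrite (le_trans (H _ uxi xiv)) // lerDl.
have [z [xz zv vz IHz]] := IH _ sx tl (fun y xy => H y (le_trans (ltW ux) xy)) hv.
exists z; rewrite (le_trans (ltW ux) xz); split => //.
have := H _ uxi (le_lt_trans xix xv'); move: IHz.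
move=> IHz hxi.
have : `|(h xi - c) * (G x - G u)| <= e * (G x - G u).
  by rewrite normrM (ger0_norm Gux) ler_wpM2r.
move: IHz; rewrite !ler_norml => /andP[? ?] /andP[? ?].
by apply/andP; split; nra.
Qed.

(** The interval [x, y] that contains v is cut at v and both halves get the tag
    v, so that each half contributes an error of at most 2 M times its increment
    of G. *)
Lemma tagged_split M d u v w l : (forall x, s <= x -> x <= t -> `|h x| <= M) ->
  s <= u -> u < v -> v < w -> w <= t -> tagged d u l w ->
  exists l1 l2 x y, [/\ tagged d u l1 v, tagged d v l2 w,
    [/\ u <= x, x <= v, v <= y & y <= w], y - x < d &
    `|tagged_sum h G u l - tagged_sum h G u l1 - tagged_sum h G v l2|
      <= 2 * M * (G y - G x)].
Proof.
move=> hM + + vw wt.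
elim: l u => [|[x xi] l IH] u su uv /=.
  by move=> /eqP uw; have := lt_trans uv vw; rewrite uw ltxx.
move=> /and4P[ux xd /andP[uxi xix] tl].
have xw := tagged_le tl.
case: (ltgtP v x) => vx.
- have sv : s <= v by rewrite (le_trans su) // ltW.
  exists [:: (v, v)], ((x, v) :: l), u, x; split => //=.
  + by rewrite uv (ltW uv) lexx eqxx !andbT /= (lt_trans _ xd) // ltrD2r.
  + by rewrite vx lexx (ltW vx) tl /= andbT (lt_trans _ xd) // ltrD2l ltrN2.
  + by rewrite lexx (ltW uv) (ltW vx).
  rewrite addr0 [X in `|X|](_ : _ = (h xi - h v) * (G x - G u)); last by ring.
  have Gux : 0 <= G x - G u by rewrite subr_ge0 Gmono // ?(ltW ux) // (le_trans xw).
  rewrite normrM (ger0_norm Gux) ler_wpM2r // mulrDl mul1r.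
  apply: (le_trans (ler_normB _ _)); apply: lerD; apply: hM => //.
  + exact: le_trans uxi.
  + exact: le_trans (le_trans xix xw) wt.
  + exact: le_trans (ltW vw) wt.
- have [l1 [l2 [y [z [t1 t2 [xy yv vz zw] zy Hl]]]]] :=
    IH x (le_trans su (ltW ux)) vx tl.
  exists ((x, xi) :: l1), l2, y, z; split => //=.
  + by rewrite ux xd uxi xix t1.
  + by split => //; rewrite (le_trans (ltW ux)).
  rewrite [X in `|X|](_ : _ =
    tagged_sum h G x l - tagged_sum h G x l1 - tagged_sum h G v l2) //.
  by ring.
- subst x; exists [:: (v, xi)], l, v, v; split => //=.
  + by rewrite ux xd uxi xix eqxx.
  + by rewrite (ltW uv) lexx (ltW vw).
  + by rewrite subrr (lt_trans _ xd) // subr_gt0.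
  rewrite addr0 subrr mulr0 [X in `|X|](_ : _ = 0) ?normr0 //.
  by ring.
Qed.

Lemma RS_dist_right u v c e I : s <= u -> u < v -> v <= t -> is_RS h G u v I ->
  (forall x, u < x -> x <= v -> `|h x - c| <= e) ->
  `|I - c * (G v - G u)| <= e * (G v - G u).
Proof.
move=> su uv vt /is_RSP HI Hh; apply/ler_addgt0Pr => r r0.
have [d d0 Hd] := HI _ r0; have [l tl al] := exists_tagged_right uv d0.
have : all (fun p => `|h p.2 - c| <= e) l.
  by apply: sub_all al => p /andP[]; exact: Hh.
move=> /(tagged_sum_dist su vt tl); have := Hd _ tl.
rewrite ltr_norml !ler_norml => /andP[? ?] /andP[? ?].
by apply/andP; split; lra.
Qed.

Lemma RS_dist_left u v c e I : s <= u -> u < v -> v <= t -> is_RS h G u v I ->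
  (forall x, u <= x -> x < v -> `|h x - c| <= e) ->
  `|I - c * (G v - G u)| <= e * (G v - G u).
Proof.
move=> su uv vt /is_RSP HI Hh; apply/ler_addgt0Pr => r r0.
have [d d0 Hd] := HI _ r0; have [l tl al] := exists_tagged_left uv d0.
have : all (fun p => `|h p.2 - c| <= e) l.
  by apply: sub_all al => p /andP[]; exact: Hh.
move=> /(tagged_sum_dist su vt tl); have := Hd _ tl.
rewrite ltr_norml !ler_norml => /andP[? ?] /andP[? ?].
by apply/andP; split; lra.
Qed.

Hypothesis (st : s < t) (hreg : regulated s t h).
Hypothesis Gr : forall x, s <= x -> x < t -> G y @[y --> x^'+] --> G x.
Hypothesis Gl : forall x, s < x -> x <= t -> G y @[y --> x^'-] --> G x.

Lemma small_right x K e : s <= x -> x < t -> 0 <= K -> 0 < e ->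
  exists2 d, 0 < d & forall y, x <= y -> y - x < d -> K * (G y - G x) <= e.
Proof.
(* Dividing by K + 1 instead of K covers the case K = 0. *)
move=> sx xt K0 e0; have K10 : 0 < K + 1 by rewrite ltr_wpDl.
have /cvgrPdist_lt/(_ (e / (K + 1)))/(_ (divr_gt0 e0 K10))/near_rightE[d d0 Hd] :=
  Gr sx xt.
exists d => // y; rewrite le_eqVlt => /predU1P[<- _|xy yd].
  by rewrite subrr mulr0 ltW.
have /Hd-/(_ xy) : y < x + d by lra.
rewrite ltr_norml ltrNl opprB => /andP[+ _].
rewrite ltr_pdivlMr // => H.
by case: (leP 0 (G y - G x)) => g; nra.
Qed.

Lemma small_left x K e : s < x -> x <= t -> 0 <= K -> 0 < e ->
  exists2 d, 0 < d & forall y, y <= x -> x - y < d -> K * (G x - G y) <= e.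
Proof.
(* Dividing by K + 1 instead of K covers the case K = 0. *)
move=> sx xt K0 e0; have K10 : 0 < K + 1 by rewrite ltr_wpDl.
have /cvgrPdist_lt/(_ (e / (K + 1)))/(_ (divr_gt0 e0 K10))/near_leftE[d d0 Hd] :=
  Gl sx xt.
exists d => // y; rewrite le_eqVlt => /predU1P[<- _|xy yd].
  by rewrite subrr mulr0 ltW.
have /Hd-/(_ xy) : x - d < y by lra.
rewrite ltr_norml => /andP[_].
rewrite ltr_pdivlMr // => H.
by case: (leP 0 (G x - G y)) => g; nra.
Qed.

(** Near x the function h is within eps of its one-sided limit c, except maybe at
    x, which only one tag can see; so c times the increment of G is a good value.
    The values of adjacent intervals add up, as the error of a cut is absorbed by
    the continuity of G at the common endpoint. *)
Lemma RS_approx eps : 0 < eps -> exists A, forall e, 0 < e ->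
  exists2 d, 0 < d & forall l, tagged d s l t ->
    `|tagged_sum h G s l - A| <= eps * (G t - G s) + e.
Proof.
move=> eps0.
have [M M0 hM] := regulated_bounded st hreg.
apply: (@interval_induction R (fun u v => exists A, forall e, 0 < e ->
  exists2 d, 0 < d & forall l, tagged d u l v ->
    `|tagged_sum h G u l - A| <= eps * (G v - G u) + e) _ _ st).
- move=> u v w su uv vw wt [A HA] [B HB]; exists (A + B) => e e0.
  have e40 : 0 < e / 4 by rewrite divr_gt0.
  have [d1 d10 H1] := HA _ e40; have [d2 d20 H2] := HB _ e40.
  have M20 : 0 <= 2 * M by rewrite mulr_ge0 // ltW.
  have [d3 d30 H3] :=
    small_right (le_trans su (ltW uv)) (lt_le_trans vw wt) M20 e40.
  have [d4 d40 H4] :=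
    small_left (le_lt_trans su uv) (le_trans (ltW vw) wt) M20 e40.
  exists (Num.min (Num.min d1 d2) (Num.min d3 d4)).
    by rewrite !lt_min d10 d20 d30.
  move=> l tl.
  have [l1 [l2 [x [y [t1 t2 [ux xv vy yw] yx Hl]]]]] := tagged_split hM su uv vw wt tl.
  have {}/H1 : tagged d1 u l1 v by apply: tagged_mesh t1; rewrite !ge_min lexx.
  have {}/H2 : tagged d2 v l2 w by apply: tagged_mesh t2; rewrite !ge_min lexx orbT.
  move: yx; rewrite !lt_min => /andP[_ /andP[yx3 yx4]].
  have {}/H3 : y - v < d3 by lra.
  have {}/H4 : v - x < d4 by lra.
  move=> /(_ xv) ? /(_ vy) ?.
  move: Hl; rewrite !ler_norml => /andP[? ?] /andP[? ?] /andP[? ?].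
  by apply/andP; split; lra.
- move=> x sx xt; set c := rightlim h x.
  have /cvgrPdist_le/(_ eps eps0)/near_rightE[d1 d10 H1] := rightlim_cvg hreg sx xt.
  apply/near_rightE; exists (Num.min d1 (t - x)); first by rewrite lt_min d10 subr_gt0.
  move=> v xv; rewrite -ltrBlDl lt_min => /andP[vd vt].
  have {}vt : v <= t by rewrite ltW // -(ltrD2r (- x)).
  exists (c * (G v - G x)) => e e0.
  have [d d0 Hd] := small_right sx xt (normr_ge0 (h x - c)) e0.
  exists d => // -[/=|[y xi] l /=]; first by rewrite lt_eqF.
  move=> /and4P[xy yd /andP[xxi xiy] tl].
  have yv := tagged_le tl.
  have cl y' : x < y' -> y' <= v -> `|h y' - c| <= eps.
    by move=> xy' y'v; rewrite distrC; apply: H1 => //; lra.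
  have [|z [yz zv _]] := @tagged_sum_dist_last d y v l c eps 0 d0
    (le_trans sx (ltW xy)) vt (lexx 0) tl
    (fun y' yy' y'v => cl _ (lt_le_trans xy yy') (ltW y'v)).
    by rewrite addr0 cl.
  rewrite mul0r addr0.
  have Gxy : 0 <= G y - G x by rewrite subr_ge0 Gmono // ?(ltW xy) // (le_trans yv).
  have h1 : `|h xi - c| <= eps + `|h x - c|.
    move: xxi; rewrite le_eqVlt => /predU1P[<-|xxi]; first by rewrite lerDr ltW.
    by rewrite (le_trans (cl _ xxi (le_trans xiy yv))) // lerDl.
  have := Hd _ (ltW xy) yd.
  have : `|(h xi - c) * (G y - G x)| <= (eps + `|h x - c|) * (G y - G x).
    by rewrite normrM (ger0_norm Gxy) ler_wpM2r.
  set K := `|h x - c|.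
  rewrite !ler_norml => /andP[? ?] ? /andP[? ?].
  by apply/andP; split; nra.
- move=> x sx xt; set c := leftlim h x.
  have /cvgrPdist_le/(_ eps eps0)/near_leftE[d1 d10 H1] := leftlim_cvg hreg sx xt.
  apply/near_leftE; exists (Num.min d1 (x - s)); first by rewrite lt_min d10 subr_gt0.
  move=> u + ux; rewrite ltrBlDr -ltrBlDl lt_min => /andP[ud us].
  have {}us : s <= u by lra.
  exists (c * (G x - G u)) => e e0.
  have [d d0 Hd] := small_left sx xt (normr_ge0 (h x - c)) e0.
  exists d => // l tl.
  have [||z [uz zx xz]] := @tagged_sum_dist_last d u x l c eps `|h x - c| d0
    us xt (normr_ge0 _) tl.
  + by move=> y uy yx; rewrite distrC; apply: H1 => //; lra.
  + by rewrite lerDr ltW.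
  by move=> /le_trans; apply; rewrite lerD2l; exact: Hd.
Qed.

(** Two values that approximate all fine sums up to e and e' differ by at most
    e + e'. Hence the supremum of the numbers A - e is within e of every A. *)
Lemma RS_exists : RS_integrable h G s t.
Proof.
pose good A e := 0 < e /\ exists2 d, 0 < d & forall l, tagged d s l t ->
  `|tagged_sum h G s l - A| <= e.
have goodP e : 0 < e -> exists A, good A e.
  move=> e0; have G0 : 0 < G t - G s + 1.
    by rewrite ltr_wpDl // subr_ge0 Gmono // ltW.
  have e20 : 0 < e / 2 by rewrite divr_gt0.
  have [A HA] := RS_approx (divr_gt0 e20 G0).
  have [d d0 Hd] := HA _ e20.
  exists A; split => //; exists d => // l /Hd /le_trans; apply.
  rewrite [leRHS](splitr e) lerD2r -mulrA ger_pMr // mulrC ler_pdivrMr // mul1r.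
  by rewrite lerDl.
have good_le A e A' e' : good A e -> good A' e' -> A - e <= A' + e'.
  move=> [e0 [d d0 Hd]] [e'0 [d' d'0 Hd']].
  have [|l tl _] := @exists_tagged_right (Num.min d d') _ _ st.
    by rewrite lt_min d0.
  have := Hd l (tagged_mesh _ tl); rewrite ge_min lexx => /(_ isT).
  have := Hd' l (tagged_mesh _ tl); rewrite ge_min lexx orbT => /(_ isT).
  by rewrite !ler_norml => /andP[? ?] /andP[? ?]; lra.
pose S := [set z | exists A e, good A e /\ z = A - e].
have [A1 gA1] := goodP 1 ltr01.
have supS : has_sup S.
  split; first by exists (A1 - 1), A1, 1.
  by exists (A1 + 1) => _ [A [e [gA ->]]]; exact: good_le.
exists (sup S); apply/is_RSP => e e0.
have e30 : 0 < e / 3 by rewrite divr_gt0.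
have [A gA] := goodP _ e30; have [_ [d d0 Hd]] := gA.
have I1 : A - e / 3 <= sup S.
  by apply: ub_le_sup; [exact: supS.2|exists A, (e / 3)].
have I2 : sup S <= A + e / 3.
  by apply: ge_sup; [exact: supS.1|move=> _ [B [r [gB ->]]]; exact: good_le].
exists d => // l /Hd; rewrite ler_norml ltr_norml => /andP[? ?].
by apply/andP; split; lra.
Qed.

End Monotone.

End RiemannStieltjes.

(** * Primitives and first-order Taylor remainders *)

Section Taylor.
Variable R : realType.
Implicit Types (psi Psi : R -> R) (u v x z c d e : R).

Notation mu := (@lebesgue_measure R).

Lemma continuous_integrable_itv psi u v : continuous psi ->
  mu.-integrable `[u, v] (EFin \o psi).
Proof.
move=> cpsi; apply: continuous_compact_integrable; first exact: segment_compact.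
exact: continuous_subspaceT.
Qed.

(** With a base point to the left of both 0 and z, the two orientations are
    treated alike. *)
Lemma oriented_intE psi e z : continuous psi -> - e < 0 -> - e < z ->
  oriented_int psi z = \int[mu]_(x in `[- e, z]) psi x -
    \int[mu]_(x in `[- e, 0]) psi x.
Proof.
move=> cpsi e0 ez; rewrite /oriented_int; case: (leP 0 z) => z0.
  rewrite Rintegral_itvB ?bnd_simp //; first last.
  - exact: ltW.
  - exact: continuous_integrable_itv.
  rewrite Rintegral_itv_obnd_cbnd //.
  apply: integrableS (@continuous_integrable_itv psi 0 z cpsi) => //.
  by apply: subset_itvr; rewrite bnd_simp.
rewrite -opprB; congr (- _); rewrite Rintegral_itvB ?bnd_simp //; first last.
- exact: ltW.
- exact: ltW.
- exact: continuous_integrable_itv.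
rewrite Rintegral_itv_obnd_cbnd //.
apply: integrableS (@continuous_integrable_itv psi z 0 cpsi) => //.
by apply: subset_itvr; rewrite bnd_simp.
Qed.

Lemma oriented_int0 psi : oriented_int psi 0 = 0.
Proof. by rewrite /oriented_int lexx set_itv1 Rintegral_set1. Qed.

Lemma is_derive_primitive psi Psi x : continuous psi ->
  (forall u, Psi u = Psi 0 + oriented_int psi u) -> is_derive x 1 Psi (psi x).
Proof.
(* - e is a base point to the left of both 0 and x. *)
move=> cpsi HPsi; pose e := `|x| + 1.
have e0 : - e < 0 by rewrite oppr_lt0 ltr_wpDl.
have ex : - e < x by rewrite ltrNl /e (le_lt_trans (ler_norm (- x))) // normrN ltrDl.
pose F z := \int[mu]_(x in `[- e, z]) psi x.
have [dF F'] : derivable F x 1 /\ derive1 F x = psi x.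
  apply: (@continuous_FTC1_closed R psi (- e) x (x + 1)) => //.
  - by rewrite ltrDl.
  - exact: continuous_integrable_itv.
  - exact: cpsi.
have isF : is_derive x 1 (fun z => Psi 0 + F z - F 0) (psi x).
  have isF0 : is_derive x 1 F (psi x) by rewrite -F' derive1E; exact: derivableP.
  rewrite -[psi x]add0r -[0 + psi x]subr0; apply: is_deriveB.
apply: near_eq_is_derive isF.
have : \forall z \near x, - e < z by exact: lt_nbhsr.
apply: filterS => z ez; rewrite (HPsi z) (oriented_intE cpsi e0 ez) addrA.
by [].
Qed.

Definition taylor_rest psi Psi u v : R := Psi v - Psi u - psi u * (v - u).

Lemma C1_continuous psi : C1 psi -> continuous psi.
Proof.
by case=> dpsi _ x; apply: differentiable_continuous; exact/derivable1_diffP.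
Qed.

Lemma norm_increment (g dg : R -> R) u v e :
  (forall x, is_derive x 1 g (dg x)) ->
  (forall x, Num.min u v <= x -> x <= Num.max u v -> `|dg x| <= e) ->
  `|g v - g u| <= e * `|v - u|.
Proof.
move=> isg; have cg : continuous g.
  by move=> x; apply: differentiable_continuous; apply/derivable1_diffP; have [] := isg x.
wlog uv : u v / u <= v.
  move=> H Hd; case: (leP u v) => [uv|/ltW vu]; first exact: H.
  by rewrite (distrC (g v)) (distrC v); apply: H => // x; rewrite minC maxC; exact: Hd.
rewrite min_l // max_r // => Hd.
have [c + ->] := @MVT_segment R g dg u v uv (fun x _ => isg x)
  (continuous_subspaceT cg).
by rewrite in_itv /= => /andP[uc cv]; rewrite normrM ler_wpM2r // Hd.
Qed.

(** The mean value theorem bounds the first-order remainder of psi, then the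
    increment of Psi minus its expansion of order two with second coefficient d / 2.
    For d = 0 this gives a quadratic bound, and for d = psi'(rho) it compares the
    remainder with the second-order term when u and v are close to rho. *)
Lemma taylor_rest_bound psi Psi u v d e : C1 psi ->
  (forall x, is_derive x 1 Psi (psi x)) ->
  (forall x, Num.min u v <= x -> x <= Num.max u v -> `|derive1 psi x - d| <= e) ->
  `|taylor_rest psi Psi u v - 2^-1 * d * (v - u) ^+ 2| <= e * (v - u) ^+ 2.
Proof.
move=> Cpsi dPsi Hd.
have dpsi x : is_derive x 1 psi (derive1 psi x).
  by rewrite derive1E; apply: derivableP; case: Cpsi.
have psiu x : Num.min u v <= x -> x <= Num.max u v ->
    `|psi x - psi u - d * (x - u)| <= e * `|x - u|.
  move=> x1 x2.
  have := @norm_increment (fun z => psi z - d * z) (fun z => derive1 psi z - d) u x e.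
  rewrite (_ : psi x - d * x - _ = psi x - psi u - d * (x - u)); last by ring.
  apply.
    by move=> z; apply: is_derive_eq; rewrite [d%:A]mulr1.
  move=> y; rewrite ge_min le_max => y1 y2; apply: Hd.
  - move: y1; rewrite !ge_min; move: x1; rewrite ge_min.
    by move=> /orP[ux|vx] /orP[uy|xy]; rewrite ?uy ?orbT //;
       rewrite ?(le_trans ux xy) ?(le_trans vx xy) ?orbT.
  - move: y2; rewrite !le_max; move: x2; rewrite le_max.
    by move=> /orP[ux|vx] /orP[uy|xy]; rewrite ?uy ?orbT //;
       rewrite ?(le_trans xy ux) ?(le_trans xy vx) ?orbT.
have := @norm_increment
  (fun z => Psi z - psi u * z - 2^-1 * d * (z - u) ^+ 2)
  (fun z => psi z - psi u - d * (z - u)) u v (e * `|v - u|).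
rewrite subrr expr0n /= mulr0 subr0 -[X in _ <= X]mulrA -normrM -expr2.
rewrite (ger0_norm (sqr_ge0 (v - u))).
rewrite (_ : Psi v - _ - _ - _ =
  taylor_rest psi Psi u v - 2^-1 * d * (v - u) ^+ 2); last first.
  by rewrite /taylor_rest; ring.
apply.
  move=> x; apply: is_derive_eq.
  by rewrite /GRing.scale /=; field.
move=> x x1 x2; apply: (le_trans (psiu _ x1 x2)).
have e0 : 0 <= e by apply: le_trans (Hd u _ _); rewrite ?ge_min ?le_max ?lexx.
apply: ler_wpM2l => //; move: x1 x2; rewrite ge_min le_max.
case: (leP u v) => uv /orP[ux|vx] /orP[xu|xv].
all: rewrite ler_norml; apply/andP; split.
1-8: rewrite (ger0_norm (_ : 0 <= v - u)); lra.
all: rewrite (ltr0_norm (_ : v - u < 0)); lra.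
Qed.

Lemma taylor_restxx psi Psi u : taylor_rest psi Psi u u = 0.
Proof. by rewrite /taylor_rest !subrr mulr0 subr0. Qed.

Lemma cvg_taylor_rest psi Psi (T : Type) (F : set_system T) (p q : T -> R) u v :
  Filter F -> continuous psi -> continuous Psi ->
  p @ F --> u -> q @ F --> v ->
  taylor_rest psi Psi (p x) (q x) @[x --> F] --> taylor_rest psi Psi u v.
Proof.
move=> FF cpsi cPsi pu qv; rewrite /taylor_rest; apply: cvgB.
  by apply: cvgB; apply: continuous_cvg => //; [exact: cPsi|exact: cPsi].
apply: cvgM; last exact: cvgB.
by apply: continuous_cvg => //; exact: cpsi.
Qed.

End Taylor.

(** * Limits of the partition sums of a kernel *)

Lemma cvg_sqr (R : realType) (T : Type) (F : set_system T) (u : T -> R) (l : R) :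
  Filter F -> u @ F --> l -> u x ^+ 2 @[x --> F] --> l ^+ 2.
Proof.
move=> FF ul; rewrite expr2 (_ : (fun x => _) = (fun x => u x * u x)).
  exact: cvgM.
by apply/funext => x; rewrite expr2.
Qed.

Section PartitionSumLimits.
Variables (R : realType) (a b : R) (lam : nat -> seq R) (f : R -> R).
Hypotheses (freg : regulated a b f) (hlam : refining_partitions a b lam).
Hypothesis hjump :
  forall t : R, a < t < b -> jumpR f t != 0 -> partition_points a lam t.
Implicit Types (u v w x y z c d e : R).

Lemma prevpt_leftlim u v : a <= u -> u < v -> v <= b ->
  f (prevpt lam u v m) @[m --> \oo] --> leftlim f v.
Proof.
move=> au uv vb; apply: cvg_comp (prevpt_cvg hlam au uv vb) _.
exact: leftlim_cvg freg (le_lt_trans au uv) vb.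
Qed.

Lemma nextpt_rightlim v w : a <= v -> v < w -> w <= b ->
  f (nextpt lam v w m) @[m --> \oo] --> rightlim f v.
Proof.
move=> av vw wb; apply: cvg_comp (nextpt_cvg hlam av vw wb) _.
exact: rightlim_cvg freg av (lt_le_trans vw wb).
Qed.

Section Kernel.
Variable K : R -> R -> R.
Hypothesis Kxx : forall z, K z z = 0.
Hypothesis Kcvg : forall (p q : nat -> R) x y,
  p @ \oo --> x -> q @ \oo --> y -> K (p m) (q m) @[m --> \oo] --> K x y.

Notation S u v m :=
  (partition_sum (fun x y => K (f x) (f y)) u (trace_partition lam u v m)).

(** At a partition point v the sums are eventually additive. Otherwise the
    interval of the partition around v shrinks to v, so that the defect tends to
    K(f(v-), f(v+)) - K(f(v-), f(v)) - K(f(v), f(v+)), which is zero because f is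
    then continuous on the right at v. The location of the right jumps of f matters
    only here. *)
Lemma trace_sum_additive u v w : a <= u -> u < v -> v < w -> w <= b ->
  S u w m - (S u v m + S v w m) @[m --> \oo] --> 0.
Proof.
move=> au uv vw wb; have av := le_lt_trans au uv; have vb := lt_le_trans vw wb.
have [vl|vl] := pselect (exists m, v \in lam m).
  apply: cvg_near_cst; case: vl => m vm; exists m => // n /= mn.
  rewrite (trace_sum_split_mem _ (refining_sorted hlam n) uv vw) ?subrr //.
  exact: (refining_subset hlam mn vm).
have fv : rightlim f v = f v.
  apply/eqP; rewrite -subr_eq0; apply: contra_notT vl => jv.
  by apply: (partition_points_mem av); apply: hjump; rewrite ?av.
have -> : (fun m => S u w m - (S u v m + S v w m)) = (fun m =>
    K (f (prevpt lam u v m)) (f (nextpt lam v w m)) -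
    K (f (prevpt lam u v m)) (f v) - K (f v) (f (nextpt lam v w m))).
  apply/funext => m.
  rewrite (trace_sum_split_notin _ (refining_sorted hlam m) uv vw).
    by rewrite addrAC subrr add0r.
  by apply/negP => vm; apply: vl; exists m.
have -> : 0 = K (leftlim f v) (rightlim f v) - K (leftlim f v) (f v)
  - K (f v) (rightlim f v) by rewrite fv Kxx subr0 subrr.
have pl := prevpt_leftlim au uv (ltW vb).
have nr := nextpt_rightlim (ltW av) vw wb.
apply: cvgB; last by apply: Kcvg => //; exact: cvg_cst.
by apply: cvgB; apply: Kcvg => //; exact: cvg_cst.
Qed.

Variable V : R -> R.
Hypothesis qV : is_qvar a b lam f V.

Notation Q u v m :=
  (partition_sum (fun x y => (f y - f x) ^+ 2) u (trace_partition lam u v m)).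

Lemma qvar_cvg u v : a <= u -> u < v -> v <= b ->
  Q u v m @[m --> \oo] --> V v - V u.
Proof. by have [_ _ H _ _] := qV; exact: H. Qed.

Lemma qvar_le u v : a <= u -> u <= v -> v <= b -> V u <= V v.
Proof.
rewrite [u <= v]le_eqVlt => au /predU1P[-> //|uv] vb; rewrite -subr_ge0.
apply: (cvgr_to_ge (qvar_cvg au uv vb)); apply: nearW => m.
by apply: partition_sum_ge0 => x y; exact: sqr_ge0.
Qed.

Lemma qvar_right x : a <= x -> x < b ->
  V v - V x - jumpR f x ^+ 2 @[v --> x^'+] --> 0.
Proof.
move=> ax xb; have [rV _ _ _ /(_ x) jV] := qV.
have <- : rightlim V x - V x - jumpR f x ^+ 2 = 0.
  by rewrite -jV ?in_itv /= ?ax // subrr.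
apply: cvgB; last exact: cvg_cst.
by apply: cvgB; [exact: rightlim_cvg rV ax xb|exact: cvg_cst].
Qed.

Lemma qvar_left x : a < x -> x <= b ->
  V x - V u - jumpL f x ^+ 2 @[u --> x^'-] --> 0.
Proof.
move=> ax xb; have [rV _ _ /(_ x) jV _] := qV.
have <- : V x - leftlim V x - jumpL f x ^+ 2 = 0.
  by rewrite -jV ?in_itv /= ?ax // subrr.
apply: cvgB; last exact: cvg_cst.
by apply: cvgB; [exact: cvg_cst|exact: leftlim_cvg rV ax xb].
Qed.

Lemma qvar_jumpR_le x v : a <= x -> x < v -> v <= b ->
  jumpR f x ^+ 2 <= V v - V x.
Proof.
move=> ax xv vb; rewrite -subr_le0.
have -> : jumpR f x ^+ 2 - (V v - V x) = - (V v - V x - jumpR f x ^+ 2) by ring.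
rewrite oppr_le0; apply: (cvgr_to_le (qvar_right ax (lt_le_trans xv vb))).
apply/near_rightE; exists (v - x); first by rewrite subr_gt0.
move=> y xy; rewrite subrKC => yv; rewrite !lerD2r.
by apply: qvar_le => //; [rewrite (le_trans ax)// ltW|exact: ltW].
Qed.

Lemma qvar_jumpL_le u x : a <= u -> u < x -> x <= b ->
  jumpL f x ^+ 2 <= V x - V u.
Proof.
move=> au ux xb; rewrite -subr_ge0.
apply: (cvgr_to_le (qvar_left (le_lt_trans au ux) xb)).
apply/near_leftE; exists (x - u); first by rewrite subr_gt0.
move=> y; rewrite subKr => uy yx; rewrite lerD2r lerD2l lerN2.
by apply: qvar_le => //; [exact: ltW|rewrite (le_trans _ xb)// ltW].
Qed.

(** The candidate limit: an additive interval function I whose increment next to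
    x is the value of K at the jump plus, up to e, the same multiple c of the rest of
    the increment of V as K is of the squared increments of f. *)
Variable I : R -> R -> R.
Hypothesis Iadd : forall u v w, a <= u -> u < v -> v < w -> w <= b ->
  I u w = I u v + I v w.
Hypothesis Iright : forall x e, a <= x -> x < b -> 0 < e ->
  exists c, \forall v \near x^'+,
    (forall y z, x < y -> y <= v -> x < z -> z <= v ->
      `|K (f y) (f z) - c * (f z - f y) ^+ 2| <= e * (f z - f y) ^+ 2) /\
    `|I x v - K (f x) (rightlim f x) - c * (V v - V x - jumpR f x ^+ 2)|
      <= e * (V v - V x - jumpR f x ^+ 2).
Hypothesis Ileft : forall x e, a < x -> x <= b -> 0 < e ->
  exists c, \forall u \near x^'-,
    (forall y z, u <= y -> y < x -> u <= z -> z < x ->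
      `|K (f y) (f z) - c * (f z - f y) ^+ 2| <= e * (f z - f y) ^+ 2) /\
    `|I u x - K (leftlim f x) (f x) - c * (V x - V u - jumpL f x ^+ 2)|
      <= e * (V x - V u - jumpL f x ^+ 2).

(** Near x, the term of the sum adjacent to x tends to the value of K at the jump.
    The remaining terms are within eps / 2 of c times squared increments of f,
    whose sum tends to the increment W of V without the jump at x. *)
Lemma trace_sum_near s t eps : a <= s -> s < t -> t <= b -> 0 < eps ->
  forall e, 0 < e -> \forall m \near \oo,
    `|S s t m - I s t| <= eps * (V t - V s) + e.
Proof.
move=> as_ st tb eps0.
have eps20 : 0 < eps / 2 by rewrite divr_gt0.
apply: (@interval_induction R (fun u v => forall e, 0 < e ->
  \forall m \near \oo, `|S u v m - I u v| <= eps * (V v - V u) + e) _ _ st).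
- move=> u v w su uv vw wt Huv Hvw e e0.
  have au := le_trans as_ su; have wb := le_trans wt tb.
  have e30 : 0 < e / 3 by rewrite divr_gt0.
  have /cvgrPdist_le/(_ _ e30) := trace_sum_additive au uv vw wb.
  apply: filter_app; apply: filter_app (Hvw _ e30); apply: filterS (Huv _ e30).
  move=> m; rewrite (Iadd au uv vw wb) sub0r normrN.
  rewrite !ler_norml => /andP[? ?] /andP[? ?] /andP[? ?].
  by apply/andP; split; lra.
- move=> x sx xt; have ax := le_trans as_ sx; have xb := lt_le_trans xt tb.
  have [c Hc] := Iright ax xb eps20.
  have vt : \forall v \near x^'+, x < v <= t.
    by apply/near_rightE; exists (t - x); rewrite ?subr_gt0 // => v -> /=;
       rewrite subrKC => /ltW.
  apply: filter_app vt; apply: filterS Hc => v [HK HI] /andP[xv vt] e e0.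
  have vb := le_trans vt tb.
  set J := jumpR f x ^+ 2 in HI *; set W := V v - V x - J in HI.
  pose r m := nextpt lam x v m.
  have fr := nextpt_rightlim ax xv vb.
  pose rest m := Q x v m - (f (r m) - f x) ^+ 2.
  have restW : rest m @[m --> \oo] --> W.
    apply: cvgB; first exact: qvar_cvg.
    apply: cvg_sqr; apply: cvgB => //; exact: cvg_cst.
  (* B m bounds the error of the sum; its limit is eps * W. *)
  pose B m := eps / 2 * rest m +
    `|K (f x) (f (r m)) - K (f x) (rightlim f x)| + `|c| * `|rest m - W| +
    eps / 2 * W.
  have BW : B m @[m --> \oo] --> eps / 2 * W + `|K (f x) (rightlim f x) -
      K (f x) (rightlim f x)| + `|c| * `|W - W| + eps / 2 * W.
    apply: cvgD; last exact: cvg_cst.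
    apply: cvgD; last first.
      apply: cvgMr; apply: cvg_norm; apply: cvgB => //; exact: cvg_cst.
    apply: cvgD; first exact: cvgMr.
    apply: cvg_norm; apply: cvgB; last exact: cvg_cst.
    by apply: Kcvg => //; exact: cvg_cst.
  have : eps / 2 * W + `|K (f x) (rightlim f x) - K (f x) (rightlim f x)| +
      `|c| * `|W - W| + eps / 2 * W < eps * (V v - V x) + e.
    have : eps * W <= eps * (V v - V x).
      by rewrite ler_pM2l // /W lerBlDr lerDl sqr_ge0.
    by rewrite !subrr normr0 mulr0; lra.
  move=> /(cvgr_lt _ BW); apply: filterS => m /ltW; apply: le_trans.
  rewrite (trace_sum_head _ lam x v m) -/(r m).
  set T := partition_sum _ (r m) _.
  have HT : `|T - c * rest m| <= eps / 2 * rest m.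
    have -> : rest m = partition_sum (fun x y => (f y - f x) ^+ 2) (r m)
        (behead (trace_partition lam x v m)).
      by rewrite /rest trace_sum_head addrC addKr.
    apply: (@partition_sum_dist _ (fun x y => K (f x) (f y))
      (fun x y => (f y - f x) ^+ 2) (fun y => x < y <= v)).
      by move=> y z /andP[xy yv] /andP[xz zv]; exact: HK.
    by move=> y; exact: mem_trace_head.
  rewrite [X in `|X|](_ : _ = (T - c * rest m) +
    (K (f x) (f (r m)) - K (f x) (rightlim f x)) + c * (rest m - W) -
    (I x v - K (f x) (rightlim f x) - c * W)); last by ring.
  apply: (le_trans (ler_normB _ _)); apply: lerD => //.
  apply: (le_trans (ler_normD _ _)); apply: lerD; last by rewrite normrM.
  by apply: (le_trans (ler_normD _ _)); rewrite lerD2r.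
- move=> x sx xt; have ax := le_lt_trans as_ sx; have xb := le_trans xt tb.
  have [c Hc] := Ileft ax xb eps20.
  have su : \forall u \near x^'-, s <= u < x.
    by apply/near_leftE; exists (x - s); rewrite ?subr_gt0 // => u + -> /=;
       rewrite subKr andbT => /ltW.
  apply: filter_app su; apply: filterS Hc => u [HK HI] /andP[su ux] e e0.
  have au := le_trans as_ su.
  set J := jumpL f x ^+ 2 in HI *; set W := V x - V u - J in HI.
  pose r m := prevpt lam u x m.
  have fr := prevpt_leftlim au ux xb.
  pose rest m := Q u x m - (f x - f (r m)) ^+ 2.
  have restW : rest m @[m --> \oo] --> W.
    apply: cvgB; first exact: qvar_cvg.
    apply: cvg_sqr; apply: cvgB => //; exact: cvg_cst.
  (* B m bounds the error of the sum; its limit is eps * W. *)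
  pose B m := eps / 2 * rest m +
    `|K (f (r m)) (f x) - K (leftlim f x) (f x)| + `|c| * `|rest m - W| +
    eps / 2 * W.
  have BW : B m @[m --> \oo] --> eps / 2 * W + `|K (leftlim f x) (f x) -
      K (leftlim f x) (f x)| + `|c| * `|W - W| + eps / 2 * W.
    apply: cvgD; last exact: cvg_cst.
    apply: cvgD; last first.
      apply: cvgMr; apply: cvg_norm; apply: cvgB => //; exact: cvg_cst.
    apply: cvgD; first exact: cvgMr.
    apply: cvg_norm; apply: cvgB; last exact: cvg_cst.
    by apply: Kcvg => //; exact: cvg_cst.
  have : eps / 2 * W + `|K (leftlim f x) (f x) - K (leftlim f x) (f x)| +
      `|c| * `|W - W| + eps / 2 * W < eps * (V x - V u) + e.
    have : eps * W <= eps * (V x - V u).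
      by rewrite ler_pM2l // /W lerBlDr lerDl sqr_ge0.
    by rewrite !subrr normr0 mulr0; lra.
  move=> /(cvgr_lt _ BW); apply: filterS => m /ltW; apply: le_trans.
  rewrite (trace_sum_last _ lam u x m) -/(r m).
  set T := partition_sum _ u _.
  have HT : `|T - c * rest m| <= eps / 2 * rest m.
    have -> : rest m = partition_sum (fun x y => (f y - f x) ^+ 2) u
        [seq y <- lam m | u < y < x].
      by rewrite /rest trace_sum_last addrK.
    apply: (@partition_sum_dist _ (fun x y => K (f x) (f y))
      (fun x y => (f y - f x) ^+ 2) (fun y => u <= y < x)).
      by move=> y z /andP[xy yv] /andP[xz zv]; exact: HK.
    by move=> y; exact: mem_trace_last.
  rewrite [X in `|X|](_ : _ = (T - c * rest m) +
    (K (f (r m)) (f x) - K (leftlim f x) (f x)) + c * (rest m - W) -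
    (I u x - K (leftlim f x) (f x) - c * W)); last by ring.
  apply: (le_trans (ler_normB _ _)); apply: lerD => //.
  apply: (le_trans (ler_normD _ _)); apply: lerD; last by rewrite normrM.
  by apply: (le_trans (ler_normD _ _)); rewrite lerD2r.
Qed.

(** Since eps is arbitrary and V increases by a finite amount, trace_sum_near
    identifies the limit. *)
Lemma trace_sum_cvg s t : a <= s -> s < t -> t <= b ->
  S s t m @[m --> \oo] --> I s t.
Proof.
move=> as_ st tb; apply/cvgrPdist_le => e e0.
have V0 : 0 <= V t - V s by rewrite subr_ge0 qvar_le // ltW.
have e20 : 0 < e / 2 by rewrite divr_gt0.
have V1 : 0 < V t - V s + 1 by rewrite ltr_wpDl.
apply: filterS (trace_sum_near as_ st tb (divr_gt0 e20 V1) e20) => m.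
rewrite distrC => /le_trans; apply; rewrite [leRHS](splitr e) lerD2r.
by rewrite -mulrA ger_pMr // mulrC ler_pdivrMr // mul1r lerDl.
Qed.

End Kernel.
End PartitionSumLimits.

(** * Jumps and continuous part of the bracket *)

Section JumpSums.
Variables (R : realType) (a b : R) (lam : nat -> seq R) (f V : R -> R).
Hypotheses (freg : regulated a b f) (qV : is_qvar a b lam f V).
Implicit Types (u v w x y z c d e : R).

Notation sqL := (fun x => jumpL f x ^+ 2).
Notation sqR := (fun x => jumpR f x ^+ 2).

Lemma near_right_avoid (l : seq R) x :
  \forall v \near x^'+, forall y, y \in l -> ~~ (x < y <= v).
Proof.
elim: l => [|y l IH]; first by apply: nearW => v y; rewrite in_nil.
have Hy : \forall v \near x^'+, ~~ (x < y <= v).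
  case: (ltP x y) => xy; last by apply: nearW.
  by apply: filterS (nbhs_right_lt xy) => v; rewrite -ltNge.
apply: filterS2 IH Hy => v Hl {}Hy z; rewrite inE => /predU1P[->//|]; exact: Hl.
Qed.

Lemma near_left_avoid (l : seq R) x :
  \forall u \near x^'-, forall y, y \in l -> ~~ (u <= y < x).
Proof.
elim: l => [|y l IH]; first by apply: nearW => v y; rewrite in_nil.
have Hy : \forall u \near x^'-, ~~ (u <= y < x).
  case: (ltP y x) => xy; last by apply: nearW => u; rewrite andbF.
  by apply: filterS (nbhs_left_gt xy) => v; rewrite andbT -ltNge.
apply: filterS2 IH Hy => v Hl {}Hy z; rewrite inE => /predU1P[->//|]; exact: Hl.
Qed.

Lemma partial_sum_le_point (g : R -> R) (A : {fset R}) x c : 0 <= c ->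
  (forall y, y \in A -> y != x -> g y = 0) -> g x <= c -> partial_sum g A <= c.
Proof.
move=> c0 g0 gx; rewrite partial_sumE; have [xA|xA] := boolP (x \in A).
  rewrite (big_fsetD1 x) //= big_seq big1 ?addr0 // => y.
  by rewrite !inE => /andP[yx yA]; exact: g0.
rewrite big_seq big1 // => y yA; apply: g0 => //.
by apply: contraNneq xA => <-.
Qed.

(** Both sides are additive over intervals, and a small one-sided neighbourhood
    of x meets the finite set A at most in x. *)
Lemma partial_sum_jumps_le s t (A : {fset R}) : a <= s -> s < t -> t <= b ->
  partial_sum (sqL \_ `]s, t]) A + partial_sum (sqR \_ `[s, t[) A <= V t - V s.
Proof.
move=> as_ st tb; apply: (@interval_induction R (fun s t =>
  partial_sum (sqL \_ `]s, t]) A + partial_sum (sqR \_ `[s, t[) A <= V t - V s)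
  _ _ st).
- move=> u v w _ uv vw _ Huv Hvw.
  have -> : sqL \_ `]u, w] = (fun x => (sqL \_ `]u, v]) x + (sqL \_ `]v, w]) x).
    by apply/funext => x; apply: patch_itvoc_split; exact: ltW.
  have -> : sqR \_ `[u, w[ = (fun x => (sqR \_ `[u, v[) x + (sqR \_ `[v, w[) x).
    by apply/funext => x; apply: patch_itvco_split; exact: ltW.
  by rewrite !partial_sumD; lra.
- move=> x sx xt; have ax := le_trans as_ sx.
  apply: filterS2 (near_right_avoid A x) (_ : \forall v \near x^'+, x < v <= t).
    move=> v HA /andP[xv vt].
    have -> : partial_sum (sqL \_ `]x, v]) A = 0.
      rewrite partial_sumE big_seq big1 // => y /HA; rewrite /patch mem_setE in_itv /=.
      by move=> /negbTE ->.
    rewrite add0r; apply: (@le_trans _ _ (sqR x)); last first.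
      by apply: (qvar_jumpR_le qV) => //; exact: le_trans tb.
    apply: (@partial_sum_le_point _ _ x); rewrite ?sqr_ge0 //.
      move=> y /HA; rewrite negb_and -leNgt -ltNge => yv yx; rewrite /patch mem_setE in_itv /=.
      case: (leP x y) => //= xy; case: ltP => // yv'; exfalso.
      have xy' : x < y by rewrite lt_neqAle eq_sym yx.
      by move: yv; rewrite leNgt xy' ltNge (ltW yv').
    by rewrite /patch; case: ifP => // _; exact: sqr_ge0.
  by apply/near_rightE; exists (t - x); rewrite ?subr_gt0 // => v -> /=;
     rewrite subrKC => /ltW.
- move=> x sx xt; have xb := le_trans xt tb.
  apply: filterS2 (near_left_avoid A x) (_ : \forall u \near x^'-, s <= u < x).
    move=> u HA /andP[su ux].
    have -> : partial_sum (sqR \_ `[u, x[) A = 0.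
      rewrite partial_sumE big_seq big1 // => y /HA; rewrite /patch mem_setE in_itv /=.
      by move=> /negbTE ->.
    rewrite addr0; apply: (@le_trans _ _ (sqL x)); last first.
      by apply: (qvar_jumpL_le qV) => //; exact: le_trans su.
    apply: (@partial_sum_le_point _ _ x); rewrite ?sqr_ge0 //.
      move=> y /HA; rewrite negb_and -leNgt -ltNge => yv yx; rewrite /patch mem_setE in_itv /=.
      case: (leP y x) => //= xy; rewrite ?andbF // andbT; case: ltP => // uy; exfalso.
      have yx' : y < x by rewrite lt_neqAle yx.
      by move: yv; rewrite ltNge (ltW uy) leNgt yx'.
    by rewrite /patch; case: ifP => // _; exact: sqr_ge0.
  by apply/near_leftE; exists (x - s); rewrite ?subr_gt0 // => v + -> /=;
     rewrite subKr andbT => /ltW.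
Qed.

Lemma usum_jumps_le s t : a <= s -> s < t -> t <= b ->
  [/\ usummable `]s, t] sqL, usummable `[s, t[ sqR &
    usum `]s, t] sqL + usum `[s, t[ sqR <= V t - V s].
Proof.
move=> as_ st tb; apply: usum_pair_bound => [x|x|A]; try exact: sqr_ge0.
exact: partial_sum_jumps_le.
Qed.

End JumpSums.

Section ContinuousPart.
Variables (R : realType) (a b : R) (lam : nat -> seq R) (f : R -> R).
Hypotheses (ab : a < b) (freg : regulated a b f).
Notation V := (bracket a b lam f).
Notation Vc := (bracketc a b lam f).
Hypothesis qV : is_qvar a b lam f V.
Implicit Types (u v w x y z c d e : R).

Notation sqL := (fun x => jumpL f x ^+ 2).
Notation sqR := (fun x => jumpR f x ^+ 2).

Lemma usummable_sqL s t : a <= s -> t <= b -> usummable `]s, t] sqL.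
Proof.
move=> as_ tb; have [H _ _] := usum_jumps_le qV (lexx a) ab (lexx b).
apply: (@usummable_dominated _ _ `]a, b]%classic _ sqL 1) => // [y /=|y|y _].
- by rewrite !in_itv /= => /andP[sy yt]; rewrite (le_lt_trans as_ sy) (le_trans yt tb).
- exact: sqr_ge0.
- by rewrite mul1r ger0_norm ?sqr_ge0.
Qed.

Lemma usummable_sqR s t : a <= s -> t <= b -> usummable `[s, t[ sqR.
Proof.
move=> as_ tb; have [_ H _] := usum_jumps_le qV (lexx a) ab (lexx b).
apply: (@usummable_dominated _ _ `[a, b[%classic _ sqR 1) => // [y /=|y|y _].
- by rewrite !in_itv /= => /andP[sy yt]; rewrite (le_trans as_ sy) (lt_le_trans yt tb).
- exact: sqr_ge0.
- by rewrite mul1r ger0_norm ?sqr_ge0.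
Qed.

Lemma bracketcB u v : a <= u -> u <= v -> v <= b ->
  Vc v - Vc u = V v - V u - usum `]u, v] sqL - usum `[u, v[ sqR.
Proof.
move=> au uv vb; rewrite /bracketc.
have ub := le_trans uv vb.
rewrite (usum_itvoc_split au uv (usummable_sqL (lexx a) ub) (usummable_sqL au vb)).
rewrite (usum_itvco_split au uv (usummable_sqR (lexx a) ub) (usummable_sqR au vb)).
by ring.
Qed.

Lemma bracketc_le u v : a <= u -> u <= v -> v <= b -> Vc u <= Vc v.
Proof.
move=> au; rewrite le_eqVlt => /predU1P[-> //|uv] vb.
rewrite -subr_ge0 (bracketcB au (ltW uv) vb).
by have [_ _] := usum_jumps_le qV au uv vb; lra.
Qed.

(** The increment of Vc from x is at most that of V without the right jump at x,
    which tends to zero. *)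
Lemma bracketc_right x : a <= x -> x < b -> Vc y @[y --> x^'+] --> Vc x.
Proof.
move=> ax xb; apply/subr_cvg0.
apply: (@squeeze_cvgr _ _ _ _ (fun=> 0) (fun v => V v - V x - jumpR f x ^+ 2)).
- apply/near_rightE; exists (b - x); first by rewrite subr_gt0.
  move=> v xv; rewrite subrKC => /ltW vb.
  rewrite subr_ge0 (bracketc_le ax (ltW xv) vb) (bracketcB ax (ltW xv) vb) /=.
  have sqR0 y : 0 <= sqR y by exact: sqr_ge0.
  have := usum_ge_point sqR0 (usummable_sqR ax vb) (_ : `[x, v[%classic x).
  rewrite /= in_itv /= lexx xv => /(_ isT) /= ?.
  have sqL0 y : 0 <= sqL y by exact: sqr_ge0.
  by have := usum_ge0 sqL0 (usummable_sqL ax vb); lra.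
- exact: cvg_cst.
- exact: (qvar_right qV ax xb).
Qed.

Lemma bracketc_left x : a < x -> x <= b -> Vc y @[y --> x^'-] --> Vc x.
Proof.
move=> ax xb.
apply: (@squeeze_cvgr _ _ _ _ (fun u => Vc x - (V x - V u - jumpL f x ^+ 2))
  (fun=> Vc x)).
- apply/near_leftE; exists (x - a); first by rewrite subr_gt0.
  move=> u; rewrite subKr => /ltW au ux.
  rewrite (bracketc_le au (ltW ux) xb) andbT lerBlDr -lerBlDl.
  rewrite (bracketcB au (ltW ux) xb).
  have sqL0 y : 0 <= sqL y by exact: sqr_ge0.
  have := usum_ge_point sqL0 (usummable_sqL au xb) (_ : `]u, x]%classic x).
  rewrite /= in_itv /= lexx ux => /(_ isT) /= ?.
  have sqR0 y : 0 <= sqR y by exact: sqr_ge0.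
  by have := usum_ge0 sqR0 (usummable_sqR au xb); lra.
- rewrite -[X in _ --> X]subr0; apply: cvgB; first exact: cvg_cst.
  exact: (qvar_left qV ax xb).
- exact: cvg_cst.
Qed.

End ContinuousPart.

(** * The change of variables formula and the equivalence *)

Section ItoFormula.
Variables (R : realType) (a b : R) (lam : nat -> seq R) (f : R -> R).
Hypotheses (ab : a < b) (freg : regulated a b f).
Notation V := (bracket a b lam f).
Notation Vc := (bracketc a b lam f).
Hypothesis qV : is_qvar a b lam f V.
Variables psi Psi : R -> R.
Hypotheses (Cpsi : C1 psi) (dPsi : forall x : R, is_derive x 1 Psi (psi x)).
Implicit Types (u v w x y z c d e r rho : R).

Notation sqL := (fun x => jumpL f x ^+ 2).
Notation sqR := (fun x => jumpR f x ^+ 2).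
Notation K := (taylor_rest psi Psi).

Definition itoL x := jumpL (Psi \o f) x - leftlim (psi \o f) x * jumpL f x.
Definition itoR x := jumpR (Psi \o f) x - (psi \o f) x * jumpR f x.

(** The expected limit of the sums of Taylor remainders over the partitions. *)
Definition ito_correction u v : R :=
  2^-1 * RS_int (derive1 psi \o f) Vc u v + usum `]u, v] itoL + usum `[u, v[ itoR.

Lemma primitive_continuous : continuous Psi.
Proof.
by move=> x; apply: differentiable_continuous; apply/derivable1_diffP; have [] := dPsi x.
Qed.

(** The summands are Taylor remainders at the jumps, hence quadratic in the size
    of the jumps; this is why their sums converge. *)
Lemma itoLE x : a < x -> x <= b -> itoL x = K (leftlim f x) (f x).
Proof.
move=> ax xb; rewrite /itoL /taylor_rest {1}/jumpL.
rewrite (leftlim_comp primitive_continuous freg ax xb).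
by rewrite (leftlim_comp (C1_continuous Cpsi) freg ax xb).
Qed.

Lemma itoRE x : a <= x -> x < b -> itoR x = K (f x) (rightlim f x).
Proof.
move=> ax xb; rewrite /itoR /taylor_rest {1}/jumpR.
by rewrite (rightlim_comp primitive_continuous freg ax xb).
Qed.

Lemma leftlim_dist x rho r : a < x -> x <= b ->
  (\forall u \near x^'-, `|f u - rho| <= r) -> `|leftlim f x - rho| <= r.
Proof.
move=> ax xb; apply: cvgr_to_le; apply: cvg_norm; apply: cvgB; last exact: cvg_cst.
exact: leftlim_cvg freg ax xb.
Qed.

Lemma rightlim_dist x rho r : a <= x -> x < b ->
  (\forall u \near x^'+, `|f u - rho| <= r) -> `|rightlim f x - rho| <= r.
Proof.
move=> ax xb; apply: cvgr_to_le; apply: cvg_norm; apply: cvgB; last exact: cvg_cst.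
exact: rightlim_cvg freg ax xb.
Qed.

Lemma ball_segment u v z rho r : `|u - rho| <= r -> `|v - rho| <= r ->
  Num.min u v <= z -> z <= Num.max u v -> `|z - rho| <= r.
Proof.
rewrite !ler_norml ge_min le_max => /andP[? ?] /andP[? ?].
by move=> /orP[?|?] /orP[?|?]; apply/andP; split; lra.
Qed.

Lemma taylor_rest_local rho e : 0 < e -> exists2 r, 0 < r &
  (forall z, `|z - rho| <= r -> `|derive1 psi z - derive1 psi rho| <= e) /\
  (forall u v, `|u - rho| <= r -> `|v - rho| <= r ->
    `|K u v - 2^-1 * derive1 psi rho * (v - u) ^+ 2| <= e * (v - u) ^+ 2).
Proof.
move=> e0; have [_ cdpsi] := Cpsi.
have /cvgrPdist_le/(_ e e0)[r /= r0 Hr] := cdpsi rho.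
have Hz z : `|z - rho| <= r / 2 -> `|derive1 psi z - derive1 psi rho| <= e.
  move=> zr; rewrite distrC; apply: Hr; rewrite /ball_ /= distrC.
  by apply: le_lt_trans zr _; rewrite gtr_pMr // invf_lt1 // ltr1n.
exists (r / 2); first by rewrite divr_gt0.
split=> // u v ur vr; apply: taylor_rest_bound => // z z1 z2.
by apply: Hz; apply: ball_segment z1 z2.
Qed.

Lemma ito_jump_bound : exists2 C, 0 <= C &
  (forall x, a < x -> x <= b -> `|itoL x| <= C * sqL x) /\
  (forall x, a <= x -> x < b -> `|itoR x| <= C * sqR x).
Proof.
have [B B0 HB] := regulated_bounded ab freg.
have NB : - B < B by rewrite gtrN.
have [_ cdpsi] := Cpsi.
have [M M0 HM] : exists2 M, 0 < M & forall x, - B <= x -> x <= B -> `|derive1 psi x| <= M.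
  apply: regulated_bounded NB _; split=> t _; apply/cvg_ex; exists (derive1 psi t).
    by apply: cvg_at_left_filter; exact: cdpsi.
  by apply: cvg_at_right_filter; exact: cdpsi.
have KM u v : `|u - 0| <= B -> `|v - 0| <= B -> `|K u v| <= M * (v - u) ^+ 2.
  move=> uB vB; have := @taylor_rest_bound _ psi Psi u v 0 M Cpsi dPsi.
  rewrite mulr0 mul0r subr0; apply => z z1 z2; rewrite subr0.
  by have := ball_segment uB vB z1 z2; rewrite subr0 ler_norml => /andP[]; exact: HM.
exists M; first exact: ltW.
split=> x ax xb.
  rewrite itoLE //; apply: KM; last by rewrite subr0 HB // ltW.
  apply: leftlim_dist => //; apply/near_leftE; exists (x - a); first by rewrite subr_gt0.
  by move=> u; rewrite subKr subr0 => au ux; apply: HB; lra.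
rewrite itoRE //; apply: KM; first by rewrite subr0 HB // ltW.
apply: rightlim_dist => //; apply/near_rightE; exists (b - x); first by rewrite subr_gt0.
by move=> u xu; rewrite subrKC subr0 => ub; apply: HB; lra.
Qed.

Lemma usummable_itoL u v : a <= u -> v <= b -> usummable `]u, v] itoL.
Proof.
move=> au vb; have [C C0 [HC _]] := ito_jump_bound.
apply: (usummable_dominated _ _ _ C0 (usummable_sqL ab qV au vb)) => // y.
  exact: sqr_ge0.
by rewrite /= in_itv /= => /andP[uy yv]; apply: HC;
  [exact: le_lt_trans uy|exact: le_trans vb].
Qed.

Lemma usummable_itoR u v : a <= u -> v <= b -> usummable `[u, v[ itoR.
Proof.
move=> au vb; have [C C0 [_ HC]] := ito_jump_bound.
apply: (usummable_dominated _ _ _ C0 (usummable_sqR ab qV au vb)) => // y.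
  exact: sqr_ge0.
by rewrite /= in_itv /= => /andP[uy yv]; apply: HC;
  [exact: le_trans uy|exact: lt_le_trans vb].
Qed.

Lemma RS_integrable_ito u v : a <= u -> u < v -> v <= b ->
  RS_integrable (derive1 psi \o f) Vc u v.
Proof.
move=> au uv vb; have [_ cdpsi] := Cpsi.
have [rl rr] := regulated_comp cdpsi freg.
apply: RS_exists => //.
- by move=> x y ux xy yv; apply: (bracketc_le ab qV) => //; [exact: le_trans ux|exact: le_trans vb].
- split=> t; rewrite in_itv /= => /andP[ut tv].
    by apply: rl; rewrite in_itv /= (le_lt_trans au ut) (le_trans tv vb).
  by apply: rr; rewrite in_itv /= (le_trans au ut) (lt_le_trans tv vb).
- by move=> x ux xv; apply: (bracketc_right ab qV); [exact: le_trans ux|exact: lt_le_trans vb].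
- by move=> x ux xv; apply: (bracketc_left ab qV); [exact: le_lt_trans ux|exact: le_trans vb].
Qed.

Lemma ito_correction_add u v w : a <= u -> u < v -> v < w -> w <= b ->
  ito_correction u w = ito_correction u v + ito_correction v w.
Proof.
move=> au uv vw wb.
have uw := lt_trans uv vw; have av := le_trans au (ltW uv).
have vb := le_trans (ltW vw) wb.
rewrite /ito_correction.
rewrite (RS_int_split uv vw (RS_integrable_ito au uv vb) (RS_integrable_ito av vw wb)
  (RS_integrable_ito au uw wb)).
rewrite (usum_itvoc_split (ltW uv) (ltW vw) (usummable_itoL au vb) (usummable_itoL av wb)).
rewrite (usum_itvco_split (ltW uv) (ltW vw) (usummable_itoR au vb) (usummable_itoR av wb)).
by ring.
Qed.

(** To the right of x the function f stays close to f(x+), so that each of the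
    three parts of the correction is, up to e, psi'(f(x+)) / 2 times the
    corresponding part of V: its continuous part, its left jumps, and its right
    jumps after x. The value f(x) enters only through the right jump at x. *)
Lemma ito_correction_right x e : a <= x -> x < b -> 0 < e ->
  exists c, \forall v \near x^'+,
    (forall y z, x < y -> y <= v -> x < z -> z <= v ->
      `|K (f y) (f z) - c * (f z - f y) ^+ 2| <= e * (f z - f y) ^+ 2) /\
    `|ito_correction x v - K (f x) (rightlim f x) - c * (V v - V x - jumpR f x ^+ 2)|
      <= e * (V v - V x - jumpR f x ^+ 2).
Proof.
move=> ax xb e0; set rho := rightlim f x; set d := derive1 psi rho.
have [r r0 [Hd HK]] := taylor_rest_local rho e0.
have /cvgrPdist_le/(_ r r0)/near_rightE[dl dl0 Hf] := rightlim_cvg freg ax xb.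
exists (2^-1 * d); apply/near_rightE.
exists (Num.min dl (b - x)); first by rewrite lt_min dl0 subr_gt0.
move=> v xv; rewrite -ltrBlDl lt_min => /andP[vdl vb].
have {}vb : v <= b by lra.
have near y : x < y -> y <= v -> `|f y - rho| <= r.
  by move=> xy yv; rewrite distrC; apply: Hf => //; lra.
have nearL y : x < y -> y <= v -> `|leftlim f y - rho| <= r.
  move=> xy yv; apply: leftlim_dist; [exact: le_lt_trans xy|exact: le_trans vb|].
  apply/near_leftE; exists (y - x); first by rewrite subr_gt0.
  by move=> u; rewrite subKr => xu uy; apply: near => //; lra.
have nearR y : x < y -> y < v -> `|rightlim f y - rho| <= r.
  move=> xy yv; apply: rightlim_dist; [lra|lra|].
  apply/near_rightE; exists (v - y); first by rewrite subr_gt0.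
  by move=> u yu; rewrite subrKC => uv; apply: near => //; lra.
split=> [y z xy yv xz zv|]; first by apply: HK; exact: near.
have RSb : `|RS_int (derive1 psi \o f) Vc x v - d * (Vc v - Vc x)| <= e * (Vc v - Vc x).
  apply: (@RS_dist_right _ x v (derive1 psi \o f)) => //.
  - by move=> y z xy yz zv; apply: (bracketc_le ab qV) => //;
      [exact: le_trans xy|exact: le_trans vb].
  - exact/RS_intP/RS_integrable_ito.
  - by move=> y xy yv; apply: Hd; exact: near.
have Lb : `|usum `]x, v] itoL - 2^-1 * d * usum `]x, v] sqL| <= e * usum `]x, v] sqL.
  apply: usum_dist; [exact: usummable_itoL|exact: (usummable_sqL ab qV)|].
  move=> y; rewrite /= in_itv /= => /andP[xy yv].
  by rewrite itoLE; [apply: HK; [exact: nearL|exact: near]|lra|lra].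
have Rb : `|usum `[x, v[ itoR - itoR x - 2^-1 * d * (usum `[x, v[ sqR - sqR x)| <=
    e * (usum `[x, v[ sqR - sqR x).
  apply: usum_punctured_dist; [exact: usummable_itoR|exact: (usummable_sqR ab qV)| |].
    by rewrite /= in_itv /= lexx.
  move=> y; rewrite /= in_itv /= => /andP[xy yv] yx.
  have {}xy : x < y by rewrite lt_neqAle eq_sym yx.
  by rewrite itoRE; [apply: HK; [apply: near => //; exact: ltW|exact: nearR]|lra|lra].
have Vc0 : 0 <= Vc v - Vc x by rewrite subr_ge0 (bracketc_le ab qV) // ltW.
have VE := bracketcB ab qV ax (ltW xv) vb.
rewrite -itoRE // /ito_correction.
move: RSb Lb Rb VE Vc0.
set RS := RS_int _ _ _ _; set L := usum _ itoL; set Rr := usum _ itoR.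
set SL := usum _ sqL; set SR := usum _ sqR; set DV := Vc v - Vc x.
move=> RSb Lb Rb VE Vc0.
have -> : V v - V x - jumpR f x ^+ 2 = DV + SL + (SR - sqR x) by rewrite /= VE; ring.
rewrite [X in `|X|](_ : _ = 2^-1 * (RS - d * DV) + (L - 2^-1 * d * SL) +
  (Rr - itoR x - 2^-1 * d * (SR - sqR x))); last by ring.
rewrite [leRHS]mulrDr [X in _ <= X + _]mulrDr.
apply: (le_trans (ler_normD _ _)); apply: lerD => //.
apply: (le_trans (ler_normD _ _)); apply: lerD => //.
rewrite normrM ger0_norm ?invr_ge0 //.
have := normr_ge0 (RS - d * DV); lra.
Qed.

Lemma ito_correction_left x e : a < x -> x <= b -> 0 < e ->
  exists c, \forall u \near x^'-,
    (forall y z, u <= y -> y < x -> u <= z -> z < x ->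
      `|K (f y) (f z) - c * (f z - f y) ^+ 2| <= e * (f z - f y) ^+ 2) /\
    `|ito_correction u x - K (leftlim f x) (f x) - c * (V x - V u - jumpL f x ^+ 2)|
      <= e * (V x - V u - jumpL f x ^+ 2).
Proof.
move=> ax xb e0; set rho := leftlim f x; set d := derive1 psi rho.
have [r r0 [Hd HK]] := taylor_rest_local rho e0.
have /cvgrPdist_le/(_ r r0)/near_leftE[dl dl0 Hf] := leftlim_cvg freg ax xb.
exists (2^-1 * d); apply/near_leftE.
exists (Num.min dl (x - a)); first by rewrite lt_min dl0 subr_gt0.
move=> v + xv; rewrite ltrBlDr -ltrBlDl lt_min => /andP[vdl va].
have {}va : a <= v by lra.
have near y : v <= y -> y < x -> `|f y - rho| <= r.
  by move=> xy yv; rewrite distrC; apply: Hf => //; lra.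
have nearL y : v < y -> y < x -> `|leftlim f y - rho| <= r.
  move=> xy yv; apply: leftlim_dist; [lra|lra|].
  apply/near_leftE; exists (y - v); first by rewrite subr_gt0.
  by move=> u; rewrite subKr => xu uy; apply: near => //; lra.
have nearR y : v <= y -> y < x -> `|rightlim f y - rho| <= r.
  move=> xy yv; apply: rightlim_dist; [lra|lra|].
  apply/near_rightE; exists (x - y); first by rewrite subr_gt0.
  by move=> u yu; rewrite subrKC => uv; apply: near => //; lra.
split=> [y z xy yv xz zv|]; first by apply: HK; exact: near.
have RSb : `|RS_int (derive1 psi \o f) Vc v x - d * (Vc x - Vc v)| <= e * (Vc x - Vc v).
  apply: (@RS_dist_left _ v x (derive1 psi \o f)) => //.
  - by move=> y z xy yz zv; apply: (bracketc_le ab qV) => //;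
      [exact: le_trans xy|exact: le_trans xb].
  - exact/RS_intP/RS_integrable_ito.
  - by move=> y xy yv; apply: Hd; exact: near.
have Lb : `|usum `]v, x] itoL - itoL x - 2^-1 * d * (usum `]v, x] sqL - sqL x)| <=
    e * (usum `]v, x] sqL - sqL x).
  apply: usum_punctured_dist; [exact: usummable_itoL|exact: (usummable_sqL ab qV)| |].
    by rewrite /= in_itv /= lexx xv.
  move=> y; rewrite /= in_itv /= => /andP[vy yx'] yx.
  have {}yx : y < x by rewrite lt_neqAle yx.
  by rewrite itoLE; [apply: HK; [exact: nearL|apply: near => //; exact: ltW]|lra|lra].
have Rb : `|usum `[v, x[ itoR - 2^-1 * d * usum `[v, x[ sqR| <= e * usum `[v, x[ sqR.
  apply: usum_dist; [exact: usummable_itoR|exact: (usummable_sqR ab qV)|].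
  move=> y; rewrite /= in_itv /= => /andP[xy yv].
  by rewrite itoRE; [apply: HK; [exact: near|exact: nearR]|lra|lra].
have Vc0 : 0 <= Vc x - Vc v by rewrite subr_ge0 (bracketc_le ab qV) // ltW.
have VE := bracketcB ab qV va (ltW xv) xb.
rewrite -itoLE // /ito_correction.
move: RSb Lb Rb VE Vc0.
set RS := RS_int _ _ _ _; set L := usum _ itoL; set Rr := usum _ itoR.
set SL := usum _ sqL; set SR := usum _ sqR; set DV := Vc x - Vc v.
move=> RSb Lb Rb VE Vc0.
have -> : V x - V v - jumpL f x ^+ 2 = DV + (SL - sqL x) + SR by rewrite /= VE; ring.
rewrite [X in `|X|](_ : _ = 2^-1 * (RS - d * DV) +
  (L - itoL x - 2^-1 * d * (SL - sqL x)) + (Rr - 2^-1 * d * SR)); last by ring.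
rewrite [leRHS]mulrDr [X in _ <= X + _]mulrDr.
apply: (le_trans (ler_normD _ _)); apply: lerD => //.
apply: (le_trans (ler_normD _ _)); apply: lerD => //.
rewrite normrM ger0_norm ?invr_ge0 //.
have := normr_ge0 (RS - d * DV); lra.
Qed.

Lemma ito_correction_cvg_right x : a <= x -> x < b ->
  ito_correction x v @[v --> x^'+] --> K (f x) (rightlim f x).
Proof.
move=> ax xb; have [c Hc] := ito_correction_right ax xb ltr01.
have W0 := qvar_right qV ax xb.
apply/cvgrPdist_le => e e0.
have Ce : 0 < e / (1 + `|c|) by rewrite divr_gt0 // ltr_pwDl.
have /cvgrPdist_le/(_ _ Ce) := W0; apply: filterS2 Hc => v [_].
set W := V v - V x - _; set k := K _ _; set i := ito_correction _ _ => H.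
rewrite sub0r normrN ler_pdivlMr ?ltr_pwDl // => HW.
rewrite distrC -[i - k](subrK (c * W)).
apply: (le_trans (ler_normD _ _)); apply: le_trans HW.
rewrite normrM [leRHS]mulrDr mulr1 (mulrC `|c|) lerD2r.
by apply: (le_trans H); rewrite mul1r ler_norm.
Qed.

Lemma ito_correction_cvg_left x : a < x -> x <= b ->
  ito_correction u x @[u --> x^'-] --> K (leftlim f x) (f x).
Proof.
move=> ax xb; have [c Hc] := ito_correction_left ax xb ltr01.
have W0 := qvar_left qV ax xb.
apply/cvgrPdist_le => e e0.
have Ce : 0 < e / (1 + `|c|) by rewrite divr_gt0 // ltr_pwDl.
have /cvgrPdist_le/(_ _ Ce) := W0; apply: filterS2 Hc => v [_].
set W := V x - V v - _; set k := K _ _; set i := ito_correction _ _ => H.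
rewrite sub0r normrN ler_pdivlMr ?ltr_pwDl // => HW.
rewrite distrC -[i - k](subrK (c * W)).
apply: (le_trans (ler_normD _ _)); apply: le_trans HW.
rewrite normrM [leRHS]mulrDr mulr1 (mulrC `|c|) lerD2r.
by apply: (le_trans H); rewrite mul1r ler_norm.
Qed.

(** The change of variables formula solved for the integral; the conditional
    gives the value zero at a. *)
Definition ito_integral t : R :=
  Psi (f t) - Psi (f a) - (if a < t then ito_correction a t else 0).

Lemma ito_integralB s t : a <= s -> s < t -> t <= b ->
  ito_integral t - ito_integral s = Psi (f t) - Psi (f s) - ito_correction s t.
Proof.
move=> as_ st tb; rewrite /ito_integral (le_lt_trans as_ st).
move: as_; rewrite le_eqVlt => /predU1P[<-|as_]; first by rewrite ltxx; ring.
by rewrite as_ (ito_correction_add (lexx a) as_ st tb); ring.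
Qed.

Lemma ito_integral_cvg_right x : a <= x -> x < b ->
  ito_integral v @[v --> x^'+] --> ito_integral x + psi (f x) * jumpR f x.
Proof.
move=> ax xb.
have -> : ito_integral x + psi (f x) * jumpR f x =
  ito_integral x + (Psi (rightlim f x) - Psi (f x) - K (f x) (rightlim f x)).
  by rewrite /taylor_rest /jumpR; ring.
apply: (@cvg_trans _ ((fun v => ito_integral x +
    (Psi (f v) - Psi (f x) - ito_correction x v)) @ x^'+)).
  apply: near_eq_cvg; apply/near_rightE; exists (b - x); first by rewrite subr_gt0.
  move=> v xv; rewrite subrKC => /ltW vb.
  by rewrite -(ito_integralB ax xv vb); ring.
apply: cvgD; first exact: cvg_cst.
apply: cvgB; last exact: ito_correction_cvg_right.
apply: cvgB; last exact: cvg_cst.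
apply: continuous_cvg; first exact: primitive_continuous.
exact: rightlim_cvg freg ax xb.
Qed.

Lemma ito_integral_cvg_left x : a < x -> x <= b ->
  ito_integral u @[u --> x^'-] --> ito_integral x - psi (leftlim f x) * jumpL f x.
Proof.
move=> ax xb.
have -> : ito_integral x - psi (leftlim f x) * jumpL f x =
  ito_integral x - (Psi (f x) - Psi (leftlim f x) - K (leftlim f x) (f x)).
  by rewrite /taylor_rest /jumpL; ring.
apply: (@cvg_trans _ ((fun u => ito_integral x -
    (Psi (f x) - Psi (f u) - ito_correction u x)) @ x^'-)).
  apply: near_eq_cvg; apply/near_leftE; exists (x - a); first by rewrite subr_gt0.
  move=> u; rewrite subKr => /ltW au ux.
  by rewrite -(ito_integralB au ux xb); ring.
apply: cvgB; first exact: cvg_cst.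
apply: cvgB; last exact: ito_correction_cvg_left.
apply: cvgB; first exact: cvg_cst.
apply: continuous_cvg; first exact: primitive_continuous.
exact: leftlim_cvg freg ax xb.
Qed.

Hypothesis hlam : refining_partitions a b lam.
Hypothesis hjump :
  forall t : R, a < t < b -> jumpR f t != 0 -> partition_points a lam t.

(** Along a partition, a Left Cauchy sum of psi o f is the telescoping sum of the
    increments of Psi o f minus the sum of the Taylor remainders. *)
Lemma is_LC_ito : is_LC a b lam (psi \o f) f ito_integral.
Proof.
have cpsi := C1_continuous Cpsi.
split.
- split=> x; rewrite in_itv /= => /andP[ax xb]; apply/cvg_ex; eexists.
    exact: ito_integral_cvg_left.
  exact: ito_integral_cvg_right.
- by rewrite /ito_integral ltxx subrr subr0.
- move=> s t as_ st tb; rewrite (ito_integralB as_ st tb).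
  have H : partition_sum (fun x y => K (f x) (f y)) s (trace_partition lam s t m)
      @[m --> \oo] --> ito_correction s t.
    apply: (trace_sum_cvg freg hlam hjump _ _ qV) => //.
    + exact: taylor_restxx.
    + by move=> p q x y; apply: cvg_taylor_rest => //; exact: primitive_continuous.
    + exact: ito_correction_add.
    + exact: ito_correction_right.
    + exact: ito_correction_left.
  have -> : (fun m => partition_sum (fun x y => (psi \o f) x * (f y - f x)) s
      (trace_partition lam s t m)) = (fun m => Psi (f t) - Psi (f s) -
      partition_sum (fun x y => K (f x) (f y)) s (trace_partition lam s t m)).
    apply/funext => m.
    rewrite -[X in Psi (f X)](last_trace_partition lam s t m).
    rewrite (@eq_partition_sum _ _ (fun x y => Psi (f y) - Psi (f x) +
      -1 * K (f x) (f y))).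
      by rewrite (@partition_sum_telescope _ _ (Psi \o f)) partition_sumZ mulN1r.
    by move=> x y; rewrite /taylor_rest /=; ring.
  by apply: cvgB => //; exact: cvg_cst.
- move=> t; rewrite in_itv /= => /andP[at_ tb].
  rewrite (leftlim_comp cpsi freg at_ tb) {1}/jumpL.
  by rewrite (leftlimP (ito_integral_cvg_left at_ tb)); ring.
- move=> s; rewrite in_itv /= => /andP[as_ sb].
  by rewrite {1}/jumpR (rightlimP (ito_integral_cvg_right as_ sb)) /=; ring.
Qed.

End ItoFormula.

Section Main.
Variables (R : realType) (a b : R) (lam : nat -> seq R) (f : R -> R).
Hypotheses (ab : a < b) (freg : regulated a b f).
Hypothesis hlam : refining_partitions a b lam.
Hypothesis hjump :
  forall t : R, a < t < b -> jumpR f t != 0 -> partition_points a lam t.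
Implicit Types (s t : R) (V Phi : R -> R).

Lemma bracketP : has_qvar a b lam f -> is_qvar a b lam f (bracket a b lam f).
Proof.
by case=> _ [V HV]; exact: (xgetI (fun=> 0) (P := [set V | is_qvar a b lam f V]) HV).
Qed.

Lemma LC_intE g Phi s t : is_LC a b lam g f Phi -> a <= s -> s < t -> t <= b ->
  LC_int a b lam g f s t = Phi t - Phi s.
Proof.
move=> HPhi as_ st tb; rewrite /LC_int.
have [_ _ H' _ _] := xgetI (fun=> 0) (P := [set Phi | is_LC a b lam g f Phi]) HPhi.
have [_ _ H _ _] := HPhi.
exact: (cvg_unique _ (H' s t as_ st tb) (H s t as_ st tb)).
Qed.

Lemma qvar_unique V W t : is_qvar a b lam f V -> is_qvar a b lam f W ->
  a <= t -> t <= b -> V t = W t.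
Proof.
move=> [_ Va HV _ _] [_ Wa HW _ _].
rewrite le_eqVlt => /predU1P[<- _|at_ tb]; first by rewrite Va Wa.
have := cvg_unique _ (HV a t (lexx a) at_ tb) (HW a t (lexx a) at_ tb).
by rewrite Va Wa !subr0; exact.
Qed.

Lemma qvar_ito : has_qvar a b lam f -> has_ito_formula a b lam f.
Proof.
move=> /bracketP qV psi Cpsi; have cpsi := C1_continuous Cpsi.
split.
  split => //; first exact: regulated_comp.
  exists (ito_integral a b lam f psi (oriented_int psi)).
  apply: is_LC_ito => // x; apply: is_derive_primitive => // u.
  by rewrite oriented_int0 add0r.
move=> Psi HPsi s t as_ st tb JL JR.
have dPsi (x : R) : is_derive x 1 Psi (psi x) by exact: is_derive_primitive.
split.
- exact: RS_integrable_ito.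
- exact: (usummable_itoL ab freg qV Cpsi dPsi).
- exact: (usummable_itoR ab freg qV Cpsi dPsi).
rewrite (LC_intE (is_LC_ito ab freg qV Cpsi dPsi hlam hjump) as_ st tb).
rewrite (ito_integralB ab freg qV Cpsi dPsi as_ st tb) /ito_correction /=.
rewrite -/JL -/JR.
by ring.
Qed.

(** The case where psi is the identity. *)
Lemma ito_LC : has_ito_formula a b lam f -> LC_integrable a b lam f f.
Proof.
move=> /(_ id)[]; last by [].
split=> [x|]; first exact: derivable_id.
rewrite (_ : derive1 id = cst 1); first by move=> x; exact: cvg_cst.
by apply/funext => y; rewrite derive1E derive_id.
Qed.

(** From (y - x)^2 = y^2 - x^2 - 2 x (y - x), applied to the values of f on the
    intervals of the partition and across the jumps. *)
Lemma LC_qvar Phi : is_LC a b lam f f Phi ->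
  is_qvar a b lam f (fun t => f t ^+ 2 - f a ^+ 2 - 2 * Phi t).
Proof.
move=> [rPhi Phia HPhi Ljump Rjump].
have cl x : a < x -> x <= b -> f t ^+ 2 - f a ^+ 2 - 2 * Phi t @[t --> x^'-] -->
    leftlim f x ^+ 2 - f a ^+ 2 - 2 * leftlim Phi x.
  move=> ax xb; apply: cvgB; last by apply: cvgMr; exact: (leftlim_cvg rPhi ax xb).
  by apply: cvgB; [apply: cvg_sqr; exact: (leftlim_cvg freg ax xb)|exact: cvg_cst].
have cr x : a <= x -> x < b -> f t ^+ 2 - f a ^+ 2 - 2 * Phi t @[t --> x^'+] -->
    rightlim f x ^+ 2 - f a ^+ 2 - 2 * rightlim Phi x.
  move=> ax xb; apply: cvgB; last by apply: cvgMr; exact: (rightlim_cvg rPhi ax xb).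
  by apply: cvgB; [apply: cvg_sqr; exact: (rightlim_cvg freg ax xb)|exact: cvg_cst].
split.
- split=> x; rewrite in_itv /= => /andP[ax xb]; apply/cvg_ex; eexists.
    exact: cl.
  exact: cr.
- by rewrite Phia; ring.
- move=> s t as_ st tb.
  rewrite (_ : _ - _ = f t ^+ 2 - f s ^+ 2 - 2 * (Phi t - Phi s)); last by ring.
  have -> : (fun m => partition_sum (fun x y => (f y - f x) ^+ 2) s
      (trace_partition lam s t m)) = (fun m => f t ^+ 2 - f s ^+ 2 - 2 *
      partition_sum (fun x y => f x * (f y - f x)) s (trace_partition lam s t m)).
    apply/funext => m.
    rewrite -[X in f X ^+ 2 - _](last_trace_partition lam s t m).
    rewrite (@eq_partition_sum _ _ (fun x y => f y ^+ 2 - f x ^+ 2 +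
      -2 * (f x * (f y - f x)))).
      by rewrite (@partition_sum_telescope _ _ (fun x => f x ^+ 2)) partition_sumZ mulNr.
    by move=> x y; ring.
  by apply: cvgB; [exact: cvg_cst|apply: cvgMr; exact: HPhi].
- move=> t tI; move: (tI); rewrite in_itv /= => /andP[at_ tb].
  have := Ljump t tI; rewrite /jumpL (leftlimP (cl _ at_ tb)) => H.
  have -> : Phi t = leftlim Phi t + leftlim f t * (f t - leftlim f t).
    by rewrite -H; ring.
  by ring.
- move=> s sI; move: (sI); rewrite in_itv /= => /andP[as_ sb].
  have := Rjump s sI; rewrite /jumpR (rightlimP (cr _ as_ sb)) => H.
  have -> : rightlim Phi s = Phi s + f s * (rightlim f s - f s).
    by rewrite -H; ring.
  by ring.
Qed.

End Main.

Theorem proposition4 (R : realType) (a b : R) (ab : a < b)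
    (f : R -> R) (freg : regulated a b f)
    (lam : nat -> seq R) (hlam : refining_partitions a b lam)
    (hjump : forall t : R, a < t < b -> jumpR f t != 0 -> partition_points a lam t) :
  (has_qvar a b lam f <-> has_ito_formula a b lam f) /\
  (has_qvar a b lam f <-> LC_integrable a b lam f f) /\
  (has_qvar a b lam f \/ has_ito_formula a b lam f \/ LC_integrable a b lam f f ->
    forall t : R, a <= t <= b ->
      LC_int a b lam f f a t = 2^-1 * (f t ^+ 2 - f a ^+ 2 - bracket a b lam f t)).
Proof.
have qi : has_qvar a b lam f -> has_ito_formula a b lam f by exact: qvar_ito.
have il : has_ito_formula a b lam f -> LC_integrable a b lam f f by exact: ito_LC.
have lq : LC_integrable a b lam f f -> has_qvar a b lam f.
  by case=> _ _ [Phi HPhi]; split => //; eexists; exact: LC_qvar HPhi.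
split; first by split => // /il/lq.
split; first by split => // /qi/il.
move=> H; have {H} [_ _ [Phi HPhi]] : LC_integrable a b lam f f.
  by case: H => [/qi/il //|[/il //|//]].
move=> t /andP[at_ tb].
have qf := LC_qvar freg HPhi.
have qV := bracketP (conj freg (ex_intro _ _ qf)).
rewrite (qvar_unique qV qf at_ tb).
move: at_; rewrite le_eqVlt => /predU1P[<-|at_].
  by rewrite /LC_int /=; have [_ -> _ _ _] := HPhi; rewrite subrr; ring.
rewrite (LC_intE HPhi (lexx a) at_ tb); have [_ -> _ _ _] := HPhi.
by field.
Qed.
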